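(* Let $G\subset\mathrm{GL}(V)$ be a complex reflection group of rank $r$ with reflection representation $V$. Let $\mathcal{H}$ be a $G$-orbit of reflecting hyperplanes of $G$, let $\mathcal{R}_{\mathcal{H}}$ be the set of reflections in $G$ fixing some hyperplane in $\mathcal{H}$ pointwise, let $N_\mathcal{H} = \langle \mathcal{R}_\mathcal{H} \rangle$ be the subgroup they generate, and let $M_\mathcal{H}=V/N_{\mathcal{H}}$ be the $G$-representation on the vector space of $N_\mathcal{H}$-orbits. Then the representation $M_\mathcal{H}$ is factorizing.
   Context: A reflection on a finite-dimensional complex vector space $V$ is an element of $\mathrm{GL}(V)$ of finite order fixing some hyperplane pointwise. A complex reflection group $G\subset\mathrm{GL}(V)$ is a finite subgroup generated by reflections, of rank $r=\dim V$; $S(V^* )$ is the algebra of polynomial functions on $V$. The subgroup $N=N_{\mathcal H}$ is a normal reflection subgroup of $G$. The $G$-representation $V/N$: there exist homogeneous algebraically independent generators $N_1,\dots,N_r$ of $S(V^* )^N$ such that $\mathrm{span}_{\mathbb{C}}\{N_1,\dots,N_r\}$ is $G$-stable; $V/N$ is identified with the dual of this $G$-module. Factorizing: an $r$-dimensional representation $M$ of $G$ is factorizing if \[\sum_{g \in G} q^{\mathrm{fix}_V(g)} t^{\mathrm{fix}_M(g)} = \prod_{i=1}^r \Big(qt+(e_i^G(V)-m_i)t+ m_i\Big)\] for some nonnegative integers $m_1,\ldots,m_r$. Here $\mathrm{fix}_W(g)=\dim\ker(1-g|_W)$ and $e_1^G(V),\dots,e_r^G(V)$ are the exponents of $G$,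 i.e. $e_i^G(V)=d_i-1$ where $d_1,\dots,d_r$ are the degrees of a set of homogeneous algebraically independent generators of $S(V^* )^G$. *)

(* Defs.v *)
From mathcomp Require Import all_boot all_order all_fingroup all_algebra.
From mathcomp Require Import all_character.
From mathcomp Require Import complex reals mpoly.

Set Implicit Arguments.
Unset Strict Implicit.
Unset Printing Implicit Defensive.

Import GRing.Theory.
Local Open Scope ring_scope.

(* V is the space 'rV_n of row vectors.  A finite subgroup of GL(V) is given   *)
(* by a faithful matrix representation rG of a finite group G.  Following the  *)
(* mathcomp convention rG (g * h) = rG g *m rG h, the group acts on row        *)
(* vectors, and on polynomials below, on the right; a subspace of V is a       *)
(* matrix up to equality of row spaces.                                        *)

Section ReflectionGroups.

Variables (F : fieldType) (n : nat).

Definition fixmx (A : 'M[F]_n) : 'M[F]_n := kermx (1%:M - A).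

Definition hyperplane (H : 'M[F]_n) : bool := ((\rank H).+1 == n)%N.

(* The fixed space of a reflection is a hyperplane, so 1 is not a reflection.  *)
(* Finiteness of the order is automatic for the elements of a finite group.    *)
Definition reflection (A : 'M[F]_n) : bool := hyperplane (fixmx A).

Variables (gT : finGroupType) (G : {group gT}).
Implicit Type rG : mx_representation F G n.

Definition complex_reflection_group rG : Prop :=
  mx_faithful rG /\ G :=: <<[set g in G | reflection (rG g)]>>%g.

Definition reflecting_hyperplane rG (H : 'M[F]_n) : Prop :=
  exists2 s, (s \in G) && reflection (rG s) & (H == fixmx (rG s))%MS.

(* <<H *m rG g>>%MS is the canonical square matrix with the row space of       *)
(* H *m rG g, so that a subspace occurs in the list through one matrix only.   *)
Definition hyperplane_orbit rG (Hs : seq 'M[F]_n) : Prop :=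
  exists2 H, reflecting_hyperplane rG H
           & Hs =i [seq <<H *m rG g>>%MS | g in G].

Definition orbit_reflections rG (Hs : seq 'M[F]_n) : {set gT} :=
  [set s in G | reflection (rG s) & has (fun H => H *m rG s == H) Hs].

Definition orbit_subgroup rG (Hs : seq 'M[F]_n) : {group gT} :=
  <<orbit_reflections rG Hs>>%G.

(* S(V^* ) is {mpoly F[n]}, with 'X_j the j-th coordinate of a row vector v.   *)
(* poly_act rG g f is the polynomial function v |-> f (v *m rG g^-1), i.e. the *)
(* usual action on functions for the right action v |-> v *m rG g on V.        *)
Definition poly_act rG (g : gT) (f : {mpoly F[n]}) : {mpoly F[n]} :=
  f \mPo [tuple \sum_(i < n) rG g^-1%g i j *: 'X_i | j < n].

Definition poly_invariant rG (A : {set gT}) (f : {mpoly F[n]}) : Prop :=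
  {in A, forall g, poly_act rG g f = f}.

Definition alg_independent (f : n.-tuple {mpoly F[n]}) : Prop :=
  forall p : {mpoly F[n]}, p \mPo f = 0 -> p = 0.

(* f consists of algebraically independent generators of S(V^* )^A, the i-th   *)
(* one being homogeneous of degree d i.                                        *)
Definition basic_invariants rG (A : {set gT}) (d : 'I_n -> nat)
    (f : n.-tuple {mpoly F[n]}) : Prop :=
  [/\ forall i, tnth f i \is (d i).-homog,
      alg_independent f,
      forall i, poly_invariant rG A (tnth f i)
    & forall h, poly_invariant rG A h -> exists p : {mpoly F[n]}, h = p \mPo f].

Definition exponents rG (e : 'I_n -> nat) : Prop :=
  exists d f, basic_invariants rG G d f /\ forall i, e i = (d i - 1)%N.

Definition dual_mx rG (g : gT) : 'M[F]_n := (rG g^-1%g)^T.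

Lemma dual_mx_repr rG : mx_repr G (dual_mx rG).
Proof.
split=> [|g h gG hG]; first by rewrite /dual_mx invg1 repr_mx1 trmx1.
by rewrite /dual_mx invMg repr_mxM ?groupV // trmx_mul.
Qed.

Definition dual_repr rG := MxRepresentation (dual_mx_repr rG).

(* rM is the G-representation V/N: the dual of the G-module spanned by basic   *)
(* invariants of N.  The matrices rU describe the action on the basis f of     *)
(* this span; their existence says that the span is G-stable.                  *)
Definition orbit_space_repr rG (N : {set gT})
    (rM : mx_representation F G n) : Prop :=
  exists d f (rU : mx_representation F G n),
    [/\ basic_invariants rG N d f,
        {in G, forall g i,
           poly_act rG g (tnth f i) = \sum_j rU g i j *: tnth f j}
      & mx_rsim rM (dual_repr rU)].

Definition fixdim rG (g : gT) : nat := \rank (fixmx (rG g)).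

(* e is the family of exponents of the reflection group rG.  The identity is   *)
(* in Z[q, t]; e i - m i is a difference of integers, possibly negative.       *)
Definition factorizing rG (e : 'I_n -> nat)
    (rM : mx_representation F G n) : Prop :=
  let q : {mpoly int[2]} := 'X_0 in
  let t : {mpoly int[2]} := 'X_1 in
  exists m : 'I_n -> nat,
    \sum_(g in G) q ^+ fixdim rG g * t ^+ fixdim rM g
    = \prod_(i < n) (q * t + ((e i)%:R - (m i)%:R) * t + (m i)%:R).

End ReflectionGroups.

(* Main.v *)
From HB Require Import structures.
Require Import Defs.
From mathcomp Require Import all_boot all_order all_fingroup all_algebra.
From mathcomp Require Import all_field all_character boolp ring.
From mathcomp Require Import complex reals mpoly.

(** Write N for the subgroup generated by the reflections of the orbit,
    N_1, ..., N_r for basic invariants of N, of degrees d_1, ..., d_r, and U for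
    the action of G on their span. Let f_j = F_j(N_1, ..., N_r), of degrees D_j,
    be basic invariants of G. The whole argument takes place in the ring S of
    polynomials, with traces of operators on its homogeneous parts.

    The sum of the operators of a coset g N has its image in F[N_1, ..., N_r],
    where g acts through U_g. Computing its trace there gives the twisted Molien
    formula (molien_coset)

      1/|N| \sum_(y in N) 1 / det(1 - T g y) = \prod_i 1 / (1 - ep_i T^d_i),

    the ep_i being the eigenvalues of U_g, each with the degree d_i of an
    eigenvector. It replaces sums over G by sums of functions of U alone.

    The main identity (twisted_trace) says that the sum over g in G of
    det(1 + U_g diag(v(d_i))) / \prod_i (1 - ep_i T^d_i) is

      |G| \prod_j (1 + v(b_j) T^(D_j - b_j)) / (1 - T^D_j)

    for certain b_j among the d_i, the same for all functions v of the degree.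
    For N trivial this is Solomon's theorem on invariant differential forms. In
    place of the exterior algebra the proof uses determinants. The Jacobian of
    the f_j with respect to the N_i is nonzero (jacobian_neq0); since it is
    multilinear in its rows, one can keep in row j only the derivatives along the
    invariants N_i of one degree b_j and still have a nonzero determinant J
    (orbit_forms_exist). The polynomials on which every g acts by det U_g^-1 are
    the products of J by invariants (semi_invariant_det): J is one of them, and
    the symmetry T -> 1/T of the Molien series shows that the dimensions agree
    in each degree. Expanding by rows the determinant of the sum of two matrices
    writes J times the operator \sum_g det(1 + U_g diag(v(d_i))) g as a sum of
    terms h |-> a L(a' h), where L maps S to J F[f]; cyclicity of the trace then
    moves the computation from S to F[f] (graded_trace_transfer), where it is
    explicit.

    With v(k) = c(k) (1 - T) - 1, a factor with ep_i = 1 has a zero at T = 1 which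
    cancels its pole, and T = 1 gives (twisted_limit)

      \sum_g \prod_(ep_i = 1) c(d_i) / d_i
        = |G| \prod_j (c(b_j) + D_j - b_j) / D_j.

    This is used twice, for cosets. For the trivial group inside N, with c = q, it
    gives the sum of q^(fix_V) over a coset g N: it is |N| times the product of
    (q + d_i - 1) / d_i over the i with ep_i = 1 (coset_fixdim_sum). The number of
    these i is the value of fix_M on the whole coset. For N inside G, with
    c(k) = (q + k - 1) t, the sum over the cosets is then
    \prod_j ((q + b_j - 1) t + D_j - b_j), because |G| = \prod_j D_j. Hence
    m_j = D_j - b_j. *)
Set Implicit Arguments.
Unset Strict Implicit.
Unset Printing Implicit Defensive.

Import GRing.Theory Num.Theory.
Local Open Scope ring_scope.

(** * Sums of rational functions and their power series *)

Section RationalSeries.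

Variable F : numFieldType.

(** This says that q times the power series with coefficients s is 1, using
    polynomials only. *)
Definition inverse_series (s : nat -> F) (q : {poly F}) : Prop :=
  forall m, 'X^m %| q * \poly_(i < m) s i - 1.

(** The numerator of \sum_(i in A) c i / q i - c0 / q0 over the product of all
    the denominators. Its vanishing can be read on the coefficients of the power
    series as well as on values at points where no denominator vanishes. *)
Definition cleared (I : finType) (A : {set I}) (c q : I -> {poly F})
    (c0 q0 : {poly F}) : {poly F} :=
  \sum_(i in A) c i * q0 * \prod_(j in A | j != i) q j
    - c0 * \prod_(j in A) q j.

Lemma inverse_series_neq0 s q : inverse_series s q -> q`_0 != 0.
Proof.
move=> /(_ 1%N); rewrite expr1 -['X]subr0 -polyC0 dvdp_XsubCl => /rootP.
rewrite !hornerE => /eqP; rewrite subr_eq0 => /eqP e.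
apply/eqP => q0; move: e; rewrite horner_coef0 q0 mul0r => /esym/eqP.
by rewrite oner_eq0.
Qed.

Lemma dvdp_Xn_all_eq0 (p : {poly F}) : (forall m, 'X^m %| p) -> p = 0.
Proof.
move=> h; apply/eqP/negPn/negP => p0.
by have := dvdp_leq p0 (h (size p)); rewrite size_polyXn ltnn.
Qed.

Section Cleared.

Variables (I : finType) (A : {set I}) (c q : I -> {poly F}) (c0 q0 : {poly F}).

Lemma horner_cleared x :
    {in A, forall i, (q i).[x] != 0} -> q0.[x] != 0 ->
  (cleared A c q c0 q0).[x] = q0.[x] * (\prod_(i in A) (q i).[x]) *
    (\sum_(i in A) (c i).[x] / (q i).[x] - c0.[x] / q0.[x]).
Proof.
move=> hq hq0; rewrite /cleared hornerD hornerN !hornerM horner_sum horner_prod.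
rewrite mulrBr; congr (_ - _); last by field.
rewrite mulr_sumr; apply: eq_bigr => i iA.
rewrite !hornerM horner_prod [in RHS](bigD1 i) //=.
by have := hq i iA => hi; field.
Qed.

Lemma cleared_eq0 x :
    {in A, forall i, (q i).[x] != 0} -> q0.[x] != 0 ->
  ((cleared A c q c0 q0).[x] == 0) =
    (\sum_(i in A) (c i).[x] / (q i).[x] == c0.[x] / q0.[x]).
Proof.
move=> hq hq0; rewrite horner_cleared // mulf_eq0 subr_eq0 mulf_eq0.
rewrite (negbTE hq0) /=.
by have /negbTE-> : \prod_(i in A) (q i).[x] != 0 by apply/prodf_neq0.
Qed.

Variables (s : I -> nat -> F) (s0 : nat -> F).
Hypotheses (hq : {in A, forall i, inverse_series (s i) (q i)}).
Hypothesis hq0 : inverse_series s0 q0.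

Let S m := \sum_(i in A) c i * (\poly_(k < m) s i k) - c0 * \poly_(k < m) s0 k.

(** Each truncated series differs from the inverse of its denominator by a
    multiple of 'X^m, which the common denominator turns into polynomials. *)
Lemma cleared_series m :
  'X^m %| q0 * (\prod_(i in A) q i) * S m - cleared A c q c0 q0.
Proof.
rewrite [X in _ %| X](_ : _ =
  \sum_(i in A) c i * q0 * (\prod_(j in A | j != i) q j)
      * (q i * \poly_(k < m) s i k - 1)
   - c0 * (\prod_(j in A) q j) * (q0 * \poly_(k < m) s0 k - 1)).
  apply: dvdp_sub; last by apply: dvdp_mull.
  by apply: (big_ind (fun p => 'X^m %| p)) => [||i iA];
     [apply: dvdp0 | apply: dvdp_add | apply/dvdp_mull/hq].
rewrite /S /cleared mulrBr mulr_sumr.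
have -> : \sum_(i in A) q0 * (\prod_(j in A) q j) * (c i * \poly_(k < m) s i k)
  = \sum_(i in A) c i * q0 * (\prod_(j in A | j != i) q j)
      * (q i * \poly_(k < m) s i k - 1)
   + \sum_(i in A) c i * q0 * (\prod_(j in A | j != i) q j).
  rewrite -big_split; apply: eq_bigr => i iA /=.
  by rewrite [in LHS](bigD1 i) //=; ring.
by ring.
Qed.

Lemma cleared_of_series :
  (forall m, 'X^m %| S m) -> cleared A c q c0 q0 = 0.
Proof.
move=> h; apply: dvdp_Xn_all_eq0 => m; have := cleared_series m.
by rewrite dvdp_subr // dvdp_mull.
Qed.

(** The common denominator has a nonzero constant term, so it is coprime to 'X^m
    and can be cancelled. *)
Lemma series_of_cleared :
  cleared A c q c0 q0 = 0 -> forall m, 'X^m %| S m.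
Proof.
move=> h m; have := cleared_series m; rewrite h subr0 Gauss_dvdpr //.
apply: coprimep_expl; rewrite -['X]subr0 -polyC0 coprimep_sym coprimep_XsubC /root.
rewrite hornerM horner_prod mulf_neq0 ?horner_coef0 //.
  exact: inverse_series_neq0 hq0.
apply/prodf_neq0 => i iA; rewrite horner_coef0.
exact: inverse_series_neq0 (hq iA).
Qed.

End Cleared.

Lemma dvdp_Xn_coef (p : {poly F}) m :
  reflect (forall i, (i < m)%N -> p`_i = 0) ('X^m %| p).
Proof.
apply: (iffP idP) => [/dvdpP[r ->] i im|h]; first by rewrite coefMXn im.
rewrite -[p](poly_take_drop m) [take_poly m p](_ : _ = 0) ?add0r.
  exact: dvdp_mull.
by apply/polyP => i; rewrite coef_take_poly coef0; case: ifP => // /h.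
Qed.

(** The passage between identities of traces, degree by degree, and identities of
    rational functions. *)
Lemma cleared_eq0_coef (I : finType) (A : {set I}) (c : I -> F) (q : I -> {poly F})
    (c0 q0 : {poly F}) (s : I -> nat -> F) (s0 : nat -> F) :
    {in A, forall i, inverse_series (s i) (q i)} -> inverse_series s0 q0 ->
  cleared A (fun i => (c i)%:P) q c0 q0 = 0 <->
    forall k, \sum_(i in A) c i * s i k = \sum_(j < k.+1) c0`_j * s0 (k - j)%N.
Proof.
move=> hq hq0.
have coefS m k : (k < m)%N ->
  (\sum_(i in A) (c i)%:P * (\poly_(k < m) s i k) - c0 * \poly_(k < m) s0 k)`_k
    = \sum_(i in A) c i * s i k - \sum_(j < k.+1) c0`_j * s0 (k - j)%N.
  move=> km; rewrite coefB coef_sum coefM; congr (_ - _); apply: eq_bigr => i _.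
    by rewrite coefCM coef_poly km.
  by rewrite coef_poly (leq_ltn_trans (leq_subr _ _) km).
split=> [h k|h].
  have /dvdp_Xn_coef/(_ k (ltnSn k)) := series_of_cleared hq hq0 h k.+1.
  by rewrite coefS // => /eqP; rewrite subr_eq0 => /eqP.
apply: (cleared_of_series hq hq0) => m; apply/dvdp_Xn_coef => k km.
by rewrite coefS // h subrr.
Qed.

(** The integers from 2 on are infinitely many points of norm different from 1;
    at such points no factor 1 - ep x^d with ep of norm 1 vanishes. *)
Lemma poly_eq0_nat (p : {poly F}) : (forall k : nat, p.[k.+2%:R] = 0) -> p = 0.
Proof.
move=> h; apply: (@roots_geq_poly_eq0 _ p [seq k.+2%:R | k <- iota 0 (size p)]).
- by apply/allP => x /mapP[k _ ->]; apply/rootP.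
- rewrite map_inj_uniq ?iota_uniq // => a b /eqP.
  by rewrite eqr_nat => /eqP[].
- by rewrite size_map size_iota.
Qed.

End RationalSeries.

(** * Generating functions of weighted monomials *)

Section WeightedMonomials.

Variables (F : numFieldType) (n : nat).
Implicit Types (ep : 'I_n -> F) (d : 'I_n -> nat) (m : 'X_{1..n}).

Definition wdeg d m : nat := \sum_i (m i * d i)%N.

(** The coefficient of 'X^k in the inverse of the polynomial spectral_poly ep d
    below. For positive weights the bound on the monomials leaves none of weight
    k out; it makes the sum finite. *)
Definition complete_sum ep d (k : nat) : F :=
  \sum_(m : 'X_{1..n < k.+1} | wdeg d m == k) \prod_i ep i ^+ m i.

Lemma mdeg_wdeg d m : (forall i, 0 < d i)%N -> (mdeg m <= wdeg d m)%N.
Proof.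
by move=> d0; rewrite mdegE; apply: leq_sum => i _; rewrite leq_pmulr.
Qed.

Definition spectral_poly ep d : {poly F} := \prod_i (1 - ep i *: 'X^(d i)).

(** Positive weights bound every exponent of a monomial of weight k by k, so that
    the two index sets describe the same monomials. *)
Lemma sum_bmnm_ffun d (V : nmodType) (G : 'X_{1..n} -> V) (k B K : nat) :
    (forall i, 0 < d i)%N -> (k < B)%N -> (k < K)%N ->
  \sum_(m : 'X_{1..n < B} | wdeg d m == k) G m =
  \sum_(b : {ffun 'I_n -> 'I_K} | wdeg d [multinom (b i : nat) | i < n] == k)
    G [multinom (b i : nat) | i < n].
Proof.
case: B K => // B [//|K] d0 kB kK.
pose h (m : 'X_{1..n}) := [ffun i => inord (m i) : 'I_K.+1].
pose h' (b : {ffun 'I_n -> 'I_K.+1}) : 'X_{1..n < B.+1} :=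
  insubd (bm0 : 'X_{1..n < B.+1}) [multinom (b i : nat) | i < n].
have hK m : wdeg d m = k -> [multinom (h m i : nat) | i < n] = m.
  move=> mk; apply/mnmP => i; rewrite mnmE ffunE inordK //.
  apply: leq_ltn_trans kK; rewrite -mk.
  by apply: leq_trans (mdeg_wdeg m d0); rewrite mdegE (bigD1 i) //= leq_addr.
have h'K (b : {ffun 'I_n -> 'I_K.+1}) :
    wdeg d [multinom (b i : nat) | i < n] = k ->
    h' b = [multinom (b i : nat) | i < n] :> 'X_{1..n}.
  move=> bk; rewrite insubdK // -topredE /= (leq_ltn_trans _ kB) //.
  by rewrite -[X in (_ <= X)%N]bk mdeg_wdeg.
rewrite (reindex_onto (fun m : 'X_{1..n < B.+1} => h m) h') => [|b /eqP bk].
  apply: eq_big => [m|m /eqP mk]; last by rewrite hK.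
  apply/eqP/andP => [mk|[/eqP hmk /eqP e]].
    have e := hK m mk; split; apply/eqP; first by rewrite e.
    by apply: val_inj; rewrite /= h'K e.
  by rewrite -e h'K.
by apply/ffunP => i; apply: val_inj; rewrite ffunE /= h'K // mnmE inord_val.
Qed.

Lemma sum_bmnm_bound d (V : nmodType) (G : 'X_{1..n} -> V) (k B : nat) :
    (forall i, 0 < d i)%N -> (k < B)%N ->
  \sum_(m : 'X_{1..n < B} | wdeg d m == k) G m =
  \sum_(m : 'X_{1..n < k.+1} | wdeg d m == k) G m.
Proof.
by move=> d0 kB; rewrite !(sum_bmnm_ffun _ (K := k.+1) d0).
Qed.

(** Modulo 'X^K every factor of the spectral polynomial is inverted by a finite
    geometric series; distributing the product of these series over their terms
    gives one term for each monomial. *)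
Lemma inverse_series_complete_sum ep d :
  (forall i, 0 < d i)%N ->
  inverse_series (complete_sum ep d) (spectral_poly ep d).
Proof.
move=> d0 K; pose g := \prod_i \sum_(b < K) (ep i *: 'X^(d i)) ^+ b.
have hg : 'X^K %| spectral_poly ep d * g - 1.
  rewrite /g /spectral_poly -big_split /=.
  apply: (big_ind (fun p => 'X^K %| p - 1)) => [|p q hp hq|i _].
  - by rewrite subrr dvdp0.
  - rewrite (_ : p * q - 1 = p * (q - 1) + (p - 1)); last by ring.
    by rewrite dvdp_add // dvdp_mull.
  - rewrite -[1 - _ *: _]opprB mulNr -subrX1 opprB addrAC subrr add0r exprZn.
    rewrite dvdpNr.
    have := leq_pmull K (d0 i); rewrite -exprM => /subnK <-.
    by rewrite exprD scalerAl dvdp_mull.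
have hc : 'X^K %| \poly_(k < K) complete_sum ep d k - g.
  apply/dvdp_Xn_coef => k kK; rewrite coefB coef_poly kK.
  rewrite /g bigA_distr_bigA coef_sum; apply/eqP; rewrite subr_eq0; apply/eqP.
  rewrite /complete_sum.
  rewrite (sum_bmnm_ffun (fun m => \prod_i ep i ^+ m i) d0 _ kK) // big_mkcond.
  apply: eq_bigr => b _ /=.
  have -> : \prod_i (ep i *: 'X^(d i)) ^+ b i
     = (\prod_i ep i ^+ b i) *: 'X^(wdeg d [multinom (b i : nat) | i < n]).
    under eq_bigr do rewrite exprZn -exprM mulnC.
    rewrite scaler_prod -expr_sum /wdeg; congr (_ *: 'X^_).
    by apply: eq_bigr => i _; rewrite mnmE.
  rewrite coefZ coefXn eq_sym; case: eqP => _; rewrite ?mulr1 ?mulr0 //.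
  by apply: eq_bigr => i _; rewrite mnmE.
rewrite [X in _ %| X](_ : _ =
  spectral_poly ep d * (\poly_(k < K) complete_sum ep d k - g)
    + (spectral_poly ep d * g - 1)); last by ring.
by rewrite dvdp_add // dvdp_mull.
Qed.

End WeightedMonomials.

(** * Substitution, derivatives and homogeneity *)

Lemma comp_mpolyA (R : comNzRingType) n k l (p : {mpoly R[n]})
    (f : n.-tuple {mpoly R[k]}) (g : k.-tuple {mpoly R[l]}) :
  (p \mPo f) \mPo g = p \mPo [tuple tnth f i \mPo g | i < n].
Proof.
rewrite [p \mPo f]comp_mpolyE [RHS]comp_mpolyE linear_sum; apply: eq_bigr => m _.
rewrite linearZ rmorph_prod; congr (_ *: _); apply: eq_bigr => i _.
by rewrite rmorphXn tnth_mktuple.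
Qed.

Lemma mpoly_ind_ring (R : comNzRingType) n (P : {mpoly R[n]} -> Prop) :
    (forall c, P c%:MP) -> (forall i, P 'X_i) ->
    (forall p q, P p -> P q -> P (p + q)) ->
    (forall p q, P p -> P q -> P (p * q)) ->
  forall p, P p.
Proof.
move=> hC hX hD hM; apply: mpolyind => [|c m p _ _ Pp].
  by rewrite -mpolyC0; apply: hC.
apply: hD => //; rewrite -mul_mpolyC; apply: (hM) => //.
have h1 : P 1 by rewrite -mpolyC1; apply: (hC).
rewrite mpolyXE_id; apply: big_ind => [//||i _]; first exact: (hM).
by elim: (m i) => // a IH; rewrite exprS; apply: (hM).
Qed.

Lemma mderiv_var (R : nzRingType) n (i j : 'I_n) :
  ('X_j)^`M(i) = (j == i)%:R :> {mpoly R[n]}.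
Proof.
rewrite mderivX mnm1E; case: eqP => [->|_]; last by rewrite scale0r.
rewrite scale1r (_ : (U_(i) - U_(i))%MM = 0%MM) ?mpolyX0 //.
by apply/mnmP => a; rewrite mnmBE subnn mnm0E.
Qed.

Lemma mderiv_comp (R : comNzRingType) n k (f : n.-tuple {mpoly R[k]}) (i : 'I_k) p :
  (p \mPo f)^`M(i) = \sum_j (p^`M(j) \mPo f) * (tnth f j)^`M(i).
Proof.
elim/mpoly_ind_ring: p => [c|j|p q hp hq|p q hp hq].
- rewrite comp_mpolyC mderivC big1 // => j _.
  by rewrite mderivC raddf0 mul0r.
- rewrite comp_mpolyXU -tnth_nth (bigD1 j) //= big1 => [|l lj].
    by rewrite addr0 mderiv_var eqxx comp_mpoly1 mul1r.
  by rewrite mderiv_var eq_sym (negbTE lj) raddf0 mul0r.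
- rewrite raddfD mderivD hp hq -big_split; apply: eq_bigr => j _.
  by rewrite mderivD raddfD mulrDl.
- rewrite rmorphM mderivM hp hq mulr_suml mulr_sumr -big_split.
  apply: eq_bigr => j _; rewrite mderivM raddfD /= !rmorphM /=; ring.
Qed.

Lemma dhomog_bigprod (R : nzRingType) n (I : finType) (G : I -> {mpoly R[n]}) e :
  (forall i, G i \is (e i).-homog) -> \prod_i G i \is (\sum_i e i).-homog.
Proof.
move=> h; elim/big_rec2: _ => [|i d p _ hp]; first exact: dhomog1.
exact: dhomogM.
Qed.

Lemma msize_homog (R : nzRingType) n k (p : {mpoly R[n]}) :
  p \is k.-homog -> (msize p <= k.+1)%N.
Proof.
move=> hp; rewrite msizeE; apply/bigmax_leqP_seq => m mp _.
by rewrite (dhomog_mf hp).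
Qed.

Section Homogeneous.

Variables (F : fieldType) (n : nat) (d : 'I_n -> nat).
Variable (f : n.-tuple {mpoly F[n]}).

Lemma dhomog_comp_monomial m :
    (forall i, tnth f i \is (d i).-homog) ->
  'X_[m] \mPo f \is (wdeg d m).-homog.
Proof.
move=> hf; rewrite comp_mpolyX; apply: dhomog_bigprod => i.
by rewrite mulnC; apply: dhomogMn.
Qed.

Hypothesis fi : alg_independent f.

Lemma comp_mpoly_inj p q : p \mPo f = q \mPo f -> p = q.
Proof.
by move=> e; apply/eqP; rewrite -subr_eq0; apply/eqP/fi; rewrite raddfB /= e subrr.
Qed.

(** A homogeneous polynomial of degree 0 is a constant, hence is not algebraically
    independent. *)
Lemma degree_gt0 i : tnth f i \is (d i).-homog -> (0 < d i)%N.
Proof.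
rewrite lt0n => hf; apply: contraTneq isT => d0; rewrite d0 in hf.
have /(congr1 (mcoeff U_(i)%MM)) : 'X_i = ((tnth f i)@_0)%:MP :> {mpoly F[n]}.
  apply: comp_mpoly_inj; rewrite comp_mpolyXU comp_mpolyC -tnth_nth.
  apply/mpolyP => m; rewrite mcoeffC; have [->|m0] := eqVneq m 0%MM.
    by rewrite mulr1.
  by rewrite mulr0; apply: dhomog_nemf_coeff hf _; rewrite mdeg_eq0.
by move/eqP; rewrite mcoeffX eqxx mcoeffC mnm1_eq0 mulr0 oner_eq0.
Qed.

End Homogeneous.

(** * Traces on homogeneous polynomials *)

Section GradedTrace.

Variables (F : numFieldType) (n : nat).
Local Notation S := {mpoly F[n]}.

(** For P linear and degree preserving, its trace on the space of homogeneous
    polynomials of degree k, computed in the basis of monomials. *)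
Definition graded_trace k (P : S -> S) : F :=
  \sum_(m : 'X_{1..n < k.+1} | mdeg m == k) (P 'X_[m])@_m.

Lemma dhomog_mpolyE k (p : S) : p \is k.-homog ->
  p = \sum_(m : 'X_{1..n < k.+1} | mdeg m == k) p@_m *: 'X_[m].
Proof.
by move=> hp; rewrite -(pihomogwE mdeg k) ?pihomog_dE //; apply: msize_homog.
Qed.

Variables (d : 'I_n -> nat) (f : n.-tuple S).
Hypotheses (hf : forall i, tnth f i \is (d i).-homog) (fi : alg_independent f).

(** Cyclicity of the trace: P is the sum of the a_i B_i, where
    B_i h = L (b_i h) / J maps S to F[f], so its trace on S is that of the sum of
    the B_i a_i on F[f]. By the hypothesis on the L (b_i a_i), the operators
    B_i a_i with l i = j together multiply a monomial in f by A j and by the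
    product of the powers of ep attached to that monomial, and they raise its
    degree by j before L is applied. The terms of degree k are therefore counted
    by monomials in f of weight k - j. *)
Lemma graded_trace_transfer (I : finType) (a b : I -> S) (l : I -> nat)
    (L : {linear S -> S}) (J : S) (P : S -> S) ep (A : nat -> F) k :
    J != 0 ->
    (forall i, a i \is (l i).-homog) ->
    (forall h, exists p, L h = J * (p \mPo f)) ->
    (forall m h, L (('X_[m] \mPo f) * h)
       = (\prod_i ep i ^+ m i) *: (('X_[m] \mPo f) * L h)) ->
    (forall j, \sum_(i | l i == j) L (b i * a i) = A j *: J) ->
    (forall h, J * P h = \sum_i a i * L (b i * h)) ->
  graded_trace k P = \sum_(j < k.+1) A j * complete_sum ep d (k - j).
Proof.
move=> J0 ha hL hLf hA hP.
have d0 i : (0 < d i)%N by apply: degree_gt0 fi _ (hf i).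
(* In the basis of monomials in f, p (i, m) holds the coordinates of B_i 'X_[m]. *)
have [p hp] := fin_all_exists
  (fun im : I * 'X_{1..n < k.+1} => hL (b im.1 * 'X_[im.2])).
pose K := maxn k.+1 (\max_(im : I * 'X_{1..n < k.+1}) msize (p im)).
have pK (im : I * 'X_{1..n < k.+1}) : (msize (p im) <= K)%N.
  by rewrite leq_max (leq_bigmax im) orbT.
have PE (m : 'X_{1..n < k.+1}) : P 'X_[m] = \sum_i a i * (p (i, m) \mPo f).
  apply: (mulfI J0); rewrite hP mulr_sumr; apply: eq_bigr => i _.
  by rewrite (hp (i, m)) mulrCA.
pose fb (be : 'X_{1..n}) := 'X_[be] \mPo f.
(* The coordinates of B_i applied to the part of degree k of a_i f^be. *)
pose c i be := \sum_(m : 'X_{1..n < k.+1} | mdeg m == k)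
  (a i * fb be)@_m *: p (i, m).
(* The exchange of the sums over m and be is the identity tr (A B) = tr (B A);
   K bounds all the monomials in f that occur. *)
have traceE : graded_trace k P = \sum_(be : 'X_{1..n < K}) \sum_i (c i be)@_be.
  rewrite exchange_big /=; under eq_bigr => i _ do
    under eq_bigr => be _ do rewrite /c raddf_sum /=.
  under eq_bigr => i _ do rewrite exchange_big /=.
  rewrite exchange_big; apply: eq_bigr => m /= mk.
  rewrite PE raddf_sum; apply: eq_bigr => i _ /=.
  rewrite {1}[p _](mpolywE (pK _)) linear_sum mulr_sumr raddf_sum /=.
  apply: eq_bigr => be _; rewrite linearZ /= -scalerAr !mcoeffZ mulrC.
  by [].
have cE i be : J * (c i be \mPo f) =
    if (l i + wdeg d be == k)%N then
      (\prod_j ep j ^+ be j) *: (fb be * L (b i * a i)) else 0.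
  have hh : a i * fb be \is (l i + wdeg d be)%N.-homog.
    by apply: dhomogM (ha i) (dhomog_comp_monomial _ hf).
  have -> : J * (c i be \mPo f) =
      L (b i * \sum_(m : 'X_{1..n < k.+1} | mdeg m == k)
                  (a i * fb be)@_m *: 'X_[m]).
    rewrite /c raddf_sum !mulr_sumr raddf_sum; apply: eq_bigr => m _ /=.
    by rewrite !linearZ /= -scalerAr -hp -scalerAr linearZ.
  case: eqP => [e|/eqP ne].
    rewrite -(@dhomog_mpolyE k) -?e // /fb -hLf; congr (L _).
    by rewrite [in RHS]mulrCA; congr (_ * _); rewrite mulrC.
  rewrite big1 ?mulr0 ?raddf0 // => m /eqP mk.
  rewrite (_ : (a i * fb be)@_m = 0) ?scale0r //.
  by apply: dhomog_nemf_coeff hh _; apply/eqP => e; case/eqP: ne; rewrite -e.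
have cS j (be : 'X_{1..n}) : \sum_(i | l i == j) (c i be)@_be =
    if (j + wdeg d be == k)%N then A j * \prod_j ep j ^+ be j else 0.
  rewrite -raddf_sum /=.
  have -> : \sum_(i | l i == j) c i be =
    (if (j + wdeg d be == k)%N then A j * \prod_j ep j ^+ be j else 0) *: 'X_[be].
    apply: (comp_mpoly_inj fi); apply: (mulfI J0).
    rewrite linear_sum mulr_sumr linearZ /=.
    rewrite (eq_bigr _ (fun i _ => cE i be)).
    rewrite (eq_bigr (fun i => if (j + wdeg d be == k)%N then
      (\prod_j ep j ^+ be j) *: (fb be * L (b i * a i)) else 0)); last first.
      by move=> i /eqP->.
    case: ifP => _; last by rewrite big1 // scale0r mulr0.
    rewrite -scaler_sumr -mulr_sumr hA -!scalerAr scalerA [X in X *: _]mulrC.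
    by rewrite [X in _ *: X]mulrC.
  by rewrite mcoeffZ mcoeffX eqxx mulr1.
have cbig i be : (k < l i)%N -> c i be = 0.
  move=> ki; apply: (comp_mpoly_inj fi); apply: (mulfI J0).
  rewrite cE raddf0 mulr0 ifN // neq_ltn orbC.
  by rewrite (leq_trans ki) ?leq_addr.
rewrite traceE (eq_bigr (fun be : 'X_{1..n < K} =>
  \sum_(j < k.+1) \sum_(i | l i == j) (c i be)@_be)); last first.
  move=> be _; rewrite (exchange_big_dep predT) //=; apply: eq_bigr => i _.
  have [ik|ki] := ltnP (l i) k.+1; last by rewrite cbig // raddf0 big1.
  by rewrite (big_pred1 (Ordinal ik)) // => j; rewrite eq_sym.
rewrite exchange_big; apply: eq_bigr => j _ /=.
under eq_bigr => be _ do rewrite cS.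
rewrite -big_mkcond /= -mulr_sumr.
congr (_ * _).
transitivity (\sum_(be : 'X_{1..n < K} | wdeg d be == (k - j)%N)
  \prod_i ep i ^+ be i).
  by apply: eq_bigl => be; rewrite -[in RHS](eqn_add2l j) subnKC // -ltnS.
apply: (@sum_bmnm_bound n d _ (fun m => \prod_i ep i ^+ m i)) => //.
by rewrite /K leq_max (leq_ltn_trans (leq_subr _ _)).
Qed.

End GradedTrace.

(** * The action on polynomials and twisted Molien series *)

Section PolynomialAction.

Variables (F : numFieldType) (gT : finGroupType) (G : {group gT}) (n : nat).
Variable rG : mx_representation F G n.
Local Notation S := {mpoly F[n]}.

HB.instance Definition _ g := GRing.RMorphism.copy (poly_act rG g)
  (comp_mpoly [tuple \sum_(i < n) rG g^-1%g i j *: 'X_i | j < n]).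
HB.instance Definition _ g := GRing.Linear.copy (poly_act rG g)
  (comp_mpoly [tuple \sum_(i < n) rG g^-1%g i j *: 'X_i | j < n]).

Lemma poly_actX g i : poly_act rG g 'X_i = \sum_(l < n) rG g^-1%g l i *: 'X_l.
Proof. by rewrite /poly_act comp_mpolyXU -tnth_nth tnth_mktuple. Qed.

Lemma poly_act_comp g k (p : {mpoly F[k]}) (f : k.-tuple S) :
  poly_act rG g (p \mPo f) = p \mPo [tuple poly_act rG g (tnth f i) | i < k].
Proof. exact: comp_mpolyA. Qed.

Lemma poly_actM g h : g \in G -> h \in G ->
  forall p, poly_act rG (g * h)%g p = poly_act rG h (poly_act rG g p).
Proof.
move=> gG hG p; rewrite [poly_act rG g p]/poly_act poly_act_comp [LHS]/poly_act.
congr (p \mPo _).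
apply: eq_from_tnth => j; rewrite !tnth_mktuple invMg repr_mxM ?groupV //.
rewrite linear_sum /=; under [RHS]eq_bigr do rewrite linearZ /= poly_actX scaler_sumr.
rewrite exchange_big; apply: eq_bigr => i _ /=; rewrite mxE scaler_suml.
by apply: eq_bigr => k _; rewrite scalerA mulrC.
Qed.

Lemma poly_act1 p : poly_act rG 1%g p = p.
Proof.
rewrite -[RHS]comp_mpoly_id; congr (p \mPo _); apply: eq_from_tnth => j.
rewrite !tnth_mktuple invg1 repr_mx1 (bigD1 j) //= mxE eqxx scale1r big1 ?addr0 //.
by move=> i ij; rewrite mxE (negbTE ij) scale0r.
Qed.

Lemma poly_act_homog g k p : p \is k.-homog -> poly_act rG g p \is k.-homog.
Proof.
move=> hp; rewrite /poly_act comp_mpolyEX big_seq; apply: rpred_sum => m mp.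
apply: rpredZ; rewrite comp_mpolyX.
have -> : k = (\sum_i m i)%N by rewrite -mdegE; apply/esym/(dhomog_mf hp mp).
apply: dhomog_bigprod => i; rewrite -{2}[m i]mul1n; apply: dhomogMn.
rewrite tnth_mktuple; apply: rpred_sum => l _; rewrite rpredZ // dhomogX.
exact/eqP/mdeg1.
Qed.

Lemma poly_act_monomial g (f : n.-tuple S) ep m :
    (forall j, poly_act rG g (tnth f j) = ep j *: tnth f j) ->
  poly_act rG g ('X_[m] \mPo f) = (\prod_j ep j ^+ m j) *: ('X_[m] \mPo f).
Proof.
move=> hep; rewrite comp_mpolyX rmorph_prod -scaler_prod; apply: eq_bigr => j _.
by rewrite rmorphXn /= hep exprZn.
Qed.

(** A constant weight c gives the operators of Molien series, and c = det U those
    whose images are semi-invariants. *)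
Definition coset_act (N : {set gT}) (c : gT -> F) (g : gT) (h : S) : S :=
  \sum_(y in N) c (g * y)%g *: poly_act rG (g * y)%g h.

Lemma coset_act_is_linear N c g : linear (coset_act N c g).
Proof.
move=> a p q; rewrite scaler_sumr -big_split; apply: eq_bigr => y _ /=.
by rewrite linearP scalerDr !scalerA mulrC.
Qed.

HB.instance Definition _ N c g := GRing.isLinear.Build F S S _
  (coset_act N c g) (coset_act_is_linear N c g).

Lemma poly_act_coset_act (N : {group gT}) c g h x :
    N \subset G -> g \in G -> x \in N ->
  poly_act rG x (coset_act N c g h) =
    \sum_(y in N) c (g * y)%g *: poly_act rG (g * (y * x))%g h.
Proof.
move=> /subsetP NG gG xN; rewrite /coset_act (linear_sum (poly_act rG x)).
apply: eq_bigr => y yN; have gyG : (g * y)%g \in G by rewrite groupM ?(NG y yN).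
by rewrite [LHS]linearZ mulgA (poly_actM gyG (NG x xN)).
Qed.

Lemma graded_trace_coset_act N c g k :
  graded_trace k (coset_act N c g) =
    \sum_(y in N) c (g * y)%g * graded_trace k (poly_act rG (g * y)%g).
Proof.
rewrite /graded_trace; under [RHS]eq_bigr do rewrite mulr_sumr.
rewrite exchange_big; apply: eq_bigr => m _; rewrite raddf_sum.
by apply: eq_bigr => y _; rewrite /= mcoeffZ.
Qed.

Section BasicInvariants.

Variables (N : {group gT}) (d : 'I_n -> nat) (f : n.-tuple S).
Hypotheses (NG : N \subset G) (hf : basic_invariants rG N d f).

Lemma coset_act_monomial c g ep m h : g \in G ->
    (forall j, poly_act rG g (tnth f j) = ep j *: tnth f j) ->
  coset_act N c g (('X_[m] \mPo f) * h) =
    (\prod_j ep j ^+ m j) *: (('X_[m] \mPo f) * coset_act N c g h).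
Proof.
move=> gG hep; rewrite mulr_sumr scaler_sumr; apply: eq_bigr => y yN.
have [_ _ finv _] := hf; have yG := subsetP NG y yN.
have hepy j : poly_act rG (g * y)%g (tnth f j) = ep j *: tnth f j.
  by rewrite poly_actM // hep linearZ /= finv.
by rewrite rmorphM /= (poly_act_monomial _ hepy) -!scalerAr -!scalerAl scalerA
  [X in X *: _]mulrC scalerA.
Qed.

(** The sum over the coset has its image in F[f], and by coset_act_monomial it
    scales the monomials in f: its trace is a count of these monomials. Formally
    this is graded_trace_transfer with a single term and a = b = J = 1. *)
Lemma molien_coset g ep k : g \in G ->
    (forall j, poly_act rG g (tnth f j) = ep j *: tnth f j) ->
  \sum_(y in N) graded_trace k (poly_act rG (g * y)%g)
    = #|N|%:R * complete_sum ep d k.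
Proof.
move=> gG hep; have [hh hi _ hgen] := hf.
pose c (_ : gT) : F := 1.
have -> : \sum_(y in N) graded_trace k (poly_act rG (g * y)%g)
    = graded_trace k (coset_act N c g).
  by rewrite graded_trace_coset_act; apply: eq_bigr => y _; rewrite mul1r.
rewrite (@graded_trace_transfer F n d f hh hi 'I_1 (fun=> 1) (fun=> 1) (fun=> 0%N)
  (coset_act N c g) 1 _ ep (fun j => (j == 0%N)%:R * #|N|%:R) k) ?oner_eq0 //.
- rewrite big_ord_recl mul1r subn0 big1 ?addr0 // => i _.
  by rewrite mul0r mul0r.
- by move=> _; apply: dhomog1.
- move=> h; suff /hgen[p e] : poly_invariant rG N (coset_act N c g h).
    by exists p; rewrite mul1r -e.
  move=> y yN; rewrite (poly_act_coset_act c h NG gG yN) /coset_act.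
  rewrite [RHS](reindex_inj (mulIg y)) /=.
  by apply: eq_bigl => z; rewrite groupMr.
- by move=> m h; apply: coset_act_monomial.
- move=> j; rewrite big_mkcond big_ord1 /= eq_sym.
  case: eqP => _; last by rewrite mul0r scale0r.
  rewrite !mul1r /coset_act (eq_bigr (fun=> 1)) => [|y _].
    by rewrite sumr_const scaler_nat.
  by rewrite rmorph1 scale1r.
- by move=> h; rewrite big_ord1 /= [1 * h]mul1r.
Qed.

End BasicInvariants.

End PolynomialAction.

(** * Traces, ranks and joint eigenvectors *)

(** A factorization A = C R through the rank of an idempotent satisfies R C = 1,
    and C R has the same trace as R C. *)
Lemma idempotent_mxtrace (F : fieldType) n (A : 'M[F]_n) :
  A *m A = A -> \tr A = (\rank A)%:R.
Proof.
move=> AA; suff tr r (C : 'M_(n, r)) (R : 'M_(r, n)) :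
    row_full C -> row_free R -> A = C *m R -> \tr A = r%:R.
  by apply: (tr _ _ _ (col_base_full A) (row_base_free A)); rewrite mulmx_base.
move=> /row_fullP[C' hC'] /row_freeP[R' hR'] e; move: AA; rewrite e => AA.
have e1 : R *m C = 1%:M.
  have /= := congr1 (fun B => C' *m B *m R') AA.
  by rewrite !mulmxA hC' mul1mx -!mulmxA hR' mulmx1.
by rewrite mxtrace_mulC e1 mxtrace1.
Qed.

Lemma rank_diag_mx (F : numFieldType) n (a : 'rV[F]_n) :
  \rank (diag_mx a) = #|[set i | a 0 i != 0]|.
Proof.
pose e := diag_mx (\row_i (a 0 i != 0)%:R : 'rV[F]_n).
have -> : \rank (diag_mx a) = \rank e.
  apply/eqP; rewrite eqn_leq; apply/andP; split.
    have -> : diag_mx a = diag_mx a *m e; last exact: mxrankM_maxr.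
    rewrite mulmx_diag; congr diag_mx; apply/rowP => i; rewrite !mxE.
    by case: eqVneq => [->|_]; rewrite ?mul0r ?mulr1.
  have -> : e = diag_mx (\row_i (a 0 i)^-1) *m diag_mx a; last exact: mxrankM_maxr.
  rewrite mulmx_diag; congr diag_mx; apply/rowP => i; rewrite !mxE.
  by case: eqVneq => [->|a0]; rewrite ?mulr0 // mulVf.
apply/eqP; rewrite -(eqr_nat F) -idempotent_mxtrace.
  rewrite mxtrace_diag -sum1dep_card natr_sum; apply/eqP; rewrite [RHS]big_mkcond.
  by apply: eq_bigr => i _; rewrite !mxE; case: ifP.
rewrite mulmx_diag; congr diag_mx; apply/rowP => i; rewrite !mxE.
by case: eqP; rewrite ?mul0r ?mulr1.
Qed.

(** The rows of P are eigenvectors of U for the eigenvalues ep, and row i only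
    involves coordinates of weight de i: eigenvalues come with a weight. *)
Definition joint_eigen (F : fieldType) n (U : 'M[F]_n) (d : 'I_n -> nat)
    (ep : 'I_n -> F) (de : 'I_n -> nat) (P : 'M[F]_n) : Prop :=
  [/\ P \in unitmx, P *m U = diag_mx (\row_i ep i) *m P
    & forall i j, P i j != 0 -> de i = d j].

Section JointEigen.

Variables (F : numClosedFieldType).

Lemma diagonalizable_finite_order n (A : 'M[F]_n.+1) m :
  (0 < m)%N -> A ^+ m = 1 -> diagonalizable A.
Proof.
move=> m0 Am; apply/diagonalizableP.
have [rs hrs] := closed_field_poly_normal ('X^m - 1 : {poly F}).
move: hrs; rewrite lead_coefXnsubC // scale1r => hrs; exists rs.
  by rewrite -separable_prod_XsubC -hrs separable_Xn_sub_1 // pnatr_eq0 -lt0n.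
rewrite -hrs; apply: mxminpoly_min.
by rewrite rmorphB rmorphXn /= horner_mx_X rmorph1 Am subrr.
Qed.

Lemma diagonalizable_repr (gT : finGroupType) (G : {group gT}) n
    (rG : mx_representation F G n) g : g \in G -> diagonalizable (rG g).
Proof.
case: n rG => [|n] rG gG.
  exists 1%:M; first exact: unitmx1.
  by rewrite /simmx_to_for; apply/is_diag_mxP => -[].
apply: (diagonalizable_finite_order (order_gt0 g)).
by rewrite -[RHS](repr_mx1 rG) -(expg_order g) repr_mxX.
Qed.

(** Preserving the weights means commuting with the diagonal matrix of weights,
    and both matrices are diagonalizable: the first has finite order. *)
Lemma joint_eigen_exists (gT : finGroupType) (G : {group gT}) n
    (rG : mx_representation F G n) (d : 'I_n -> nat) g :
    g \in G -> (forall i j, rG g i j != 0 -> d i = d j) ->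
  exists ed : ('I_n -> F) * ('I_n -> nat), exists P,
    joint_eigen (rG g) d ed.1 ed.2 P.
Proof.
move=> gG hb; pose D := diag_mx (\row_j (d j)%:R : 'rV[F]_n).
have cUD : comm_mx (rG g) D.
  rewrite /comm_mx /D mul_diag_mx mul_mx_diag; apply/matrixP => i j; rewrite !mxE.
  have [->|/hb->] := eqVneq (rG g i j) 0; first by rewrite mul0r mulr0.
  by rewrite mulrC.
have [P Pu /= /and3P[hU hD _]] : codiagonalizable [:: rG g; D].
  apply/codiagonalizableP; split.
    move=> A B; rewrite !inE => /orP[]/eqP-> /orP[]/eqP-> //.
  move=> A; rewrite !inE => /orP[]/eqP->; first exact: diagonalizable_repr.
  exact: diagonalizable_diag.
have [a ha] := diagonalizable_forPex hU; have [b hb'] := diagonalizable_forPex hD.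
have /(simmxP Pu) ea := ha; have /(simmxP Pu) eb := hb'.
pose de i := if [pick j | P i j != 0] is Some j then d j else 0%N.
exists (fun i => a 0 i, de), P; split=> //=.
  by rewrite ea; congr (diag_mx _ *m _); apply/rowP => i; rewrite mxE.
have PD i j : P i j != 0 -> (d j)%:R = b 0 i.
  move=> Pij; have /matrixP/(_ i j) := eb.
  by rewrite mul_diag_mx mul_mx_diag !mxE [RHS]mulrC => /(mulfI Pij).
move=> i j Pij; rewrite /de; case: pickP => [l Pil|/(_ j)]; last by rewrite Pij.
by apply/eqP; rewrite -(eqr_nat F) (PD _ _ Pil) (PD _ _ Pij).
Qed.

End JointEigen.

Section JointEigenDet.

Variables (F : numFieldType) (n : nat) (U P : 'M[F]_n).
Variables (d de : 'I_n -> nat) (ep : 'I_n -> F).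
Hypothesis hP : joint_eigen U d ep de P.

(** In the basis of the rows of P, diagonal matrices that depend on the weight
    only stay diagonal. *)
Lemma joint_eigen_det (u w : nat -> F) :
  \det (diag_mx (\row_i u (d i)) + U *m diag_mx (\row_i w (d i))) =
    \prod_i (u (de i) + ep i * w (de i)).
Proof.
have [Pu PU hd] := hP.
have Pd (v : nat -> F) : P *m diag_mx (\row_i v (d i))
    = diag_mx (\row_i v (de i)) *m P.
  apply/matrixP => i j; rewrite mul_diag_mx mul_mx_diag !mxE.
  have [->|/hd->] := eqVneq (P i j) 0; first by rewrite mul0r mulr0.
  by rewrite mulrC.
have P0 : \det P != 0 by rewrite -unitfE -unitmxE.
apply: (mulfI P0); rewrite -det_mulmx mulmxDr Pd mulmxA PU -mulmxA Pd mulmxA.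
rewrite -mulmxDl det_mulmx mulrC mulmx_diag -raddfD det_diag; congr (_ * _).
by apply: eq_bigr => i _; rewrite !mxE.
Qed.

Lemma joint_eigen_rank :
  \rank (kermx (1%:M - U)) = #|[set i | ep i == 1]|.
Proof.
have [Pu PU _] := hP.
pose D := diag_mx (\row_i (1 - ep i)).
have -> : \rank (kermx (1%:M - U)) = (n - \rank D)%N.
  rewrite mxrank_ker; congr (n - _)%N.
  have : P *m (1%:M - U) = D *m P.
    rewrite mulmxBr mulmx1 PU -{1}[P]mul1mx -mulmxBl; congr (_ *m _).
    by apply/matrixP => i j; rewrite !mxE; case: eqP; rewrite ?subrr ?mulr0n.
  move=> e; have <- : \rank (D *m P) = \rank D.
    by rewrite mxrankMfree // row_free_unit.
  by rewrite -e (eqmxMfull (1%:M - U)) // row_full_unit.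
rewrite /D rank_diag_mx [RHS]cardsCs card_ord; congr (n - _)%N; apply: eq_card => i.
by rewrite !inE mxE subr_eq0 eq_sym.
Qed.

End JointEigenDet.

(** * The Jacobian of basic invariants *)

Section Derivation.

Variables (R : comNzRingType) (D : {additive R -> R}).
Hypothesis DM : forall a b, D (a * b) = D a * b + a * D b.

Lemma coef_map_additive (Q : {poly R}) k : (map_poly D Q)`_k = D Q`_k.
Proof. by apply: coef_map_id0; apply: raddf0. Qed.

Lemma derivation_horner (Q : {poly R}) p :
  D Q.[p] = (map_poly D Q).[p] + Q^`().[p] * D p.
Proof.
elim/poly_ind: Q => [|Q c IH].
  by rewrite map_poly0 deriv0 !horner0 raddf0 mul0r addr0.
have -> : map_poly D (Q * 'X + c%:P) = map_poly D Q * 'X + (D c)%:P.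
  apply/polyP => k; rewrite coef_map_additive !coefD !coefMX !coefC raddfD.
  by case: k => [|k]; rewrite /= ?raddf0 ?coef_map_additive.
rewrite hornerMXaddC raddfD DM IH derivMXaddC hornerD hornerMX hornerMXaddC /=.
ring.
Qed.

End Derivation.

Lemma monic_of_coef (R : nzRingType) (p : {poly R}) m :
  (size p <= m.+1)%N -> p`_m = 1 -> size p = m.+1 /\ p \is monic.
Proof.
move=> sp pm; suff e : size p = m.+1 by split; rewrite ?monicE ?lead_coefE ?e ?pm.
apply/eqP; rewrite eqn_leq sp ltnNge; apply/negP => /leq_sizeP/(_ m (leqnn m)).
by move/eqP; rewrite pm oner_eq0.
Qed.

(** An annihilator of least degree has x as a simple root: otherwise its
    derivative, made monic by inverting the degree, would be a shorter one. *)
Lemma minimal_annihilator (A B : comNzRingType) (phi : {rmorphism A -> B}) x Q :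
    (forall m, exists c : A, c * m.+1%:R = 1) ->
    Q \is monic -> (map_poly phi Q).[x] = 0 ->
  exists2 P : {poly A}, (map_poly phi P).[x] = 0 & (map_poly phi P)^`().[x] != 0.
Proof.
move=> natV; have [s] := ubnP (size Q); elim: s Q => // s IH Q sQ Qm Q0.
have [Qx|] := eqVneq ((map_poly phi Q)^`().[x]) 0; last by exists Q.
have sQ1 : (1 < size Q)%N.
  rewrite ltnNge; apply/negP => /size1_polyC sQ1; move: Q0 Qm.
  rewrite sQ1 map_polyC hornerC monicE lead_coefC => /= Q0 /eqP Q1.
  by move/eqP: Q0; rewrite Q1 rmorph1 oner_eq0.
have [m sm] : {m | size Q = m.+2} by exists (size Q).-2; case: (size Q) sQ1 => [|[]].
have [c hc] := natV m.
pose Q1 := c *: Q^`().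
have [sQ' mQ'] : size Q1 = m.+1 /\ Q1 \is monic.
  apply: monic_of_coef.
    apply: leq_trans (size_scale_leq _ _) _.
    by rewrite -ltnS -sm; apply: lt_size_deriv; rewrite monic_neq0.
  by move: Qm; rewrite coefZ coef_deriv monicE lead_coefE sm => /eqP->.
apply: (IH Q1) => //; first by rewrite sQ' -ltnS -sm.
by rewrite map_polyZ -deriv_map hornerZ Qx mulr0.
Qed.

Section Jacobian.

Variables (F : numFieldType) (n : nat).
Local Notation S := {mpoly F[n]}.

Definition jacobian (f : n.-tuple S) : 'M[S]_n :=
  \matrix_(j, i) (tnth f j)^`M(i).

(** The monic polynomial whose roots are the translates of 'X_i under N has
    invariant coefficients, so 'X_i is algebraic over F[f], and it is a simple
    root of some polynomial P over F[f]. Differentiating P.['X_i] = 0 along all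
    variables shows that the Jacobian matrix is a right factor of a diagonal
    matrix with entries - P^`().['X_i], which are nonzero. *)
Lemma jacobian_neq0 (gT : finGroupType) (G N : {group gT})
    (rG : mx_representation F G n) d f : N \subset G ->
  basic_invariants rG N d f -> \det (jacobian f) != 0.
Proof.
move=> /subsetP NG [_ fi _ fgen].
have ann i : exists P : {poly S}, (map_poly (comp_mpoly f) P).['X_i] = 0
    /\ (map_poly (comp_mpoly f) P)^`().['X_i] != 0.
  pose W : {poly S} := \prod_(g in N) ('X - (poly_act rG g 'X_i)%:P).
  have Winv k : poly_invariant rG N W`_k.
    move=> y yG; rewrite -coef_map.
    suff -> : map_poly (poly_act rG y) W = W by [].
    rewrite /W rmorph_prod [RHS](reindex_inj (mulIg y)) /=.
    apply: eq_big => [z|z zG]; first by rewrite groupMr.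
    by rewrite rmorphB /= map_polyX map_polyC /= poly_actM ?NG.
  have [q hq] := fin_all_exists (fun k : 'I_(size W) => fgen _ (Winv k)).
  pose Q : {poly S} := \poly_(k < size W) (if insub k is Some k' then q k' else 0).
  have WQ : map_poly (comp_mpoly f) Q = W.
    apply/polyP => k; rewrite coef_map coef_poly.
    case: ltnP => [kW|/leq_sizeP->]; rewrite ?raddf0 // insubT /= -hq.
    by [].
  have Wm : W \is monic by apply: monic_prod => g _; apply: monicXsubC.
  have W1 : (size W).-1.+1 = size W by rewrite prednK // size_poly_gt0 monic_neq0.
  have [_ Qm] : size Q = (size W).-1.+1 /\ Q \is monic.
    apply: monic_of_coef; first by rewrite W1 size_poly.
    apply: (comp_mpoly_inj fi); rewrite -[LHS]coef_map /= WQ rmorph1.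
    by move: Wm; rewrite monicE => /eqP.
  have [|//||P hP1 hP2] := @minimal_annihilator _ _ (comp_mpoly f) 'X_i Q.
    - move=> m; exists (m.+1%:R^-1%:MP).
      by rewrite -mpolyC_nat -mpolyCM mulVf ?pnatr_eq0.
    rewrite WQ /W (bigD1 1%g) //= poly_act1 hornerM hornerXsubC subrr.
    by rewrite mul0r.
  by exists P.
have [P hP] := fin_all_exists ann.
(* Row i holds the derivatives of the coefficients of P i, taken with respect to
   the invariants f j, evaluated at 'X_i. *)
pose Af : 'M[S]_n := \matrix_(i, j)
  \sum_(k < size (P i)) (((P i)`_k)^`M(j) \mPo f) * 'X_i ^+ k.
have e : Af *m jacobian f =
    diag_mx (\row_i - (map_poly (comp_mpoly f) (P i))^`().['X_i]).
  apply/matrixP => i l; rewrite !mxE.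
  have [h0 _] := hP i; have := congr1 (mderiv l) h0.
  rewrite mderiv0 (derivation_horner (mderivM l)) => /eqP; rewrite addr_eq0 => /eqP h1.
  move: h1 => /=; rewrite mderiv_var.
  have -> : (map_poly (mderiv l) (map_poly (comp_mpoly f) (P i))).['X_i]
      = \sum_j Af i j * jacobian f j l.
    rewrite (@horner_coef_wide _ (size (P i))); last first.
      by apply: leq_trans (size_poly _ _) (size_poly _ _).
    under [RHS]eq_bigr do rewrite !mxE mulr_suml.
    rewrite exchange_big; apply: eq_bigr => k _ /=.
    rewrite coef_map_additive coef_map /= mderiv_comp mulr_suml.
    by apply: eq_bigr => j _; rewrite mulrAC.
  move=> e; rewrite (eq_bigr (fun j => Af i j * jacobian f j l)) => [|j _]; last first.
    by rewrite !mxE.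
  rewrite e; case: eqP => [->|_]; last by rewrite mulr0 oppr0.
  by rewrite mulr1.
have : \det (Af *m jacobian f) != 0.
  rewrite e det_diag; apply/prodf_neq0 => i _; rewrite mxE oppr_eq0.
  by case: (hP i).
by rewrite det_mulmx mulf_eq0 negb_or => /andP[].
Qed.

End Jacobian.

(** * Linear substitutions and weighted derivatives *)

Section LinearSubstitution.

Variables (F : fieldType) (n : nat).

Definition lin_tuple k (A : 'M[F]_n) (f : n.-tuple {mpoly F[k]}) :=
  [tuple \sum_j A i j *: tnth f j | i < n].

Definition lin_sub (A : 'M[F]_n) (p : {mpoly F[n]}) : {mpoly F[n]} :=
  p \mPo lin_tuple A [tuple 'X_i | i < n].

Lemma lin_sub_comp k A p (f : n.-tuple {mpoly F[k]}) :
  lin_sub A p \mPo f = p \mPo lin_tuple A f.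
Proof.
rewrite comp_mpolyA; congr (p \mPo _); apply: eq_from_tnth => i.
rewrite !tnth_mktuple linear_sum; apply: eq_bigr => j _ /=.
by rewrite linearZ /= tnth_mktuple comp_mpolyXU -tnth_nth.
Qed.

Lemma lin_subM A B p : lin_sub B (lin_sub A p) = lin_sub (A *m B) p.
Proof.
rewrite {1}/lin_sub lin_sub_comp; congr (p \mPo _); apply: eq_from_tnth => i.
rewrite !tnth_mktuple; under [LHS]eq_bigr do rewrite tnth_mktuple scaler_sumr.
rewrite exchange_big; apply: eq_bigr => j _; rewrite mxE scaler_suml.
by apply: eq_bigr => l _; rewrite scalerA.
Qed.

Lemma lin_sub1 p : lin_sub 1%:M p = p.
Proof.
rewrite -[RHS]comp_mpoly_id; congr (p \mPo _); apply: eq_from_tnth => i.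
rewrite !tnth_mktuple (bigD1 i) //= mxE eqxx scale1r tnth_mktuple.
rewrite big1 ?addr0 // => j ij.
by rewrite mxE eq_sym (negbTE ij) scale0r.
Qed.

End LinearSubstitution.

(** The determinant is multilinear in the rows. Splitting each row along the
    blocks of columns with equal d expresses det M as the sum of these
    determinants over all choices of b. *)
Lemma det_row_blocks (F : numFieldType) n k (M : 'M[{mpoly F[k]}]_n) (d : 'I_n -> nat) :
  \det M != 0 -> exists b : 'I_n -> nat,
    \det (\matrix_(j, i) (if d i == b j then M j i else 0)) != 0.
Proof.
pose B := (\max_i d i).+1.
have dB i : (d i < B)%N by rewrite ltnS leq_bigmax.
have -> : \det M = \sum_(b : {ffun 'I_n -> 'I_B})
    \det (\matrix_(j, i) (if d i == b j then M j i else 0)).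
  rewrite exchange_big; apply: eq_bigr => s _; rewrite -mulr_sumr; congr (_ * _).
  under [RHS]eq_bigr do under eq_bigr do rewrite mxE.
  rewrite -(bigA_distr_bigA (fun j (v : 'I_B) => if d (s j) == v then M j (s j) else 0)).
  apply: eq_bigr => j _; rewrite -big_mkcond /= (big_pred1 (Ordinal (dB (s j)))) //.
move=> h; apply/not_existsP => hb; case/eqP: h; apply: big1 => b _.
by apply/eqP/negPn/negP => /(hb (fun j => b j)).
Qed.

Lemma dhomog_det (R : comNzRingType) n k (M : 'M[{mpoly R[k]}]_n) e :
    (forall j i, M j i \is (e j).-homog) ->
  \det M \is (\sum_j e j).-homog.
Proof.
move=> h; apply: rpred_sum => s _; rewrite -signr_odd.
have : \prod_j M j (s j) \is (\sum_j e j).-homog by apply: dhomog_bigprod.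
by case: odd => hp; rewrite ?expr0 ?expr1 ?mul1r // mulN1r dhomogN.
Qed.

Section WeightedInvariants.

Variables (F : numFieldType) (n : nat) (d : 'I_n -> nat).
Variable (nf : n.-tuple {mpoly F[n]}).
Hypotheses (hh : forall i, tnth nf i \is (d i).-homog) (hi : alg_independent nf).

(** The monomials in nf are independent and homogeneous of degree their weight, so
    that a homogeneous value only involves monomials of one weight. *)
Lemma weighted_homog (p : {mpoly F[n]}) k m :
  p \mPo nf \is k.-homog -> p@_m != 0 -> wdeg d m = k.
Proof.
move=> hp pm; apply/eqP; apply: contraNT pm => mk.
have -> : p = \sum_(l <- msupp p | wdeg d l == k) p@_l *: 'X_[l].
  apply: (comp_mpoly_inj hi); rewrite -(pihomog_dE hp) comp_mpolyEX !linear_sum.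
  rewrite [RHS]big_mkcond; apply: eq_bigr => l _ /=; rewrite !linearZ /=.
  have hl := dhomog_comp_monomial l hh.
  case: eqP => [e|/eqP ne]; first by rewrite pihomog_dE -?e.
  by rewrite (pihomog_ne0 ne hl) scaler0.
rewrite raddf_sum big1 // => l /eqP lk; rewrite /= mcoeffZ mcoeffX.
by case: eqP => [e|]; [rewrite -e lk eqxx in mk | rewrite mulr0].
Qed.

(** By mderiv_weighted_leq the subtraction only truncates when the derivative
    vanishes. *)
Lemma mderiv_weighted (p : {mpoly F[n]}) k i :
  p \mPo nf \is k.-homog -> p^`M(i) \mPo nf \is (k - d i).-homog.
Proof.
move=> hp; rewrite comp_mpolyEX big_seq; apply: rpred_sum => m.
rewrite mcoeff_msupp mcoeff_deriv -mulr_natr mulf_eq0 negb_or => /andP[pm _].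
have <- := weighted_homog hp pm; apply: rpredZ.
rewrite (_ : _ - _ = wdeg d m)%N; first exact: dhomog_comp_monomial.
rewrite /wdeg (eq_bigr (fun j => m j * d j + U_(i)%MM j * d j)%N) => [|j _].
  rewrite big_split /= [X in (_ + X)%N](bigD1 i) //= mnm1E eqxx mul1n.
  by rewrite [X in (_ + (_ + X))%N]big1 ?addn0 ?addnK // => j ji;
    rewrite mnm1E eq_sym (negbTE ji).
by rewrite mnmDE mulnDl.
Qed.

Lemma mderiv_weighted_leq (p : {mpoly F[n]}) k i :
  p \mPo nf \is k.-homog -> p^`M(i) != 0 -> (d i <= k)%N.
Proof.
move=> hp; rewrite -msupp_eq0; case E : (msupp _) => [//|m s] _.
have : m \in msupp p^`M(i) by rewrite E mem_head.
rewrite mcoeff_msupp mcoeff_deriv -mulr_natr mulf_eq0 negb_or => /andP[pm _].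
rewrite -(weighted_homog hp pm) /wdeg (bigD1 i) //= mnmDE mnm1E eqxx addn1.
by rewrite mulSn -addnA leq_addr.
Qed.

End WeightedInvariants.

Section EigenInvariants.

Variables (F : numFieldType) (gT : finGroupType) (G N : {group gT}) (n : nat).
Variables (rG : mx_representation F G n) (d : 'I_n -> nat).
Variable (nf : n.-tuple {mpoly F[n]}).
Hypothesis hnf : basic_invariants rG N d nf.
Variable U : gT -> 'M[F]_n.
Hypothesis hU : {in G, forall g i,
  poly_act rG g (tnth nf i) = \sum_j U g i j *: tnth nf j}.

Let hh i : tnth nf i \is (d i).-homog. Proof. by case: hnf. Qed.
Let hi : alg_independent nf. Proof. by case: hnf. Qed.

Lemma poly_act_lin_sub g p : g \in G ->
  poly_act rG g (p \mPo nf) = lin_sub (U g) p \mPo nf.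
Proof.
move=> gG; rewrite poly_act_comp lin_sub_comp; congr (p \mPo _).
by apply: eq_from_tnth => i; rewrite !tnth_mktuple hU.
Qed.

(** The polynomial action preserves degrees, and nf is independent. *)
Lemma orbit_action_block g i j : g \in G -> U g i j != 0 -> d i = d j.
Proof.
move=> gG Uij; pose p : {mpoly F[n]} := \sum_l U g i l *: 'X_l.
have hp : p \mPo nf \is (d i).-homog.
  have -> : p \mPo nf = poly_act rG g (tnth nf i); last exact: poly_act_homog.
  rewrite hU // linear_sum; apply: eq_bigr => l _.
  by rewrite /= linearZ /= comp_mpolyXU -tnth_nth.
have pj : p@_U_(j) = U g i j.
  rewrite raddf_sum (bigD1 j) //= mcoeffZ mcoeffX eqxx mulr1 big1 ?addr0 // => l lj.
  by rewrite mcoeffZ mcoeffX eq_mnm1 (negbTE lj) mulr0.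
rewrite -(weighted_homog hh hi hp (m := U_(j)%MM)) ?pj //.
rewrite /wdeg (bigD1 j) //= mnm1E eqxx mul1n big1 ?addn0 // => l lj.
by rewrite mnm1E eq_sym (negbTE lj).
Qed.

Lemma orbit_action1 g : g \in N -> N \subset G -> U g = 1%:M.
Proof.
move=> gN /subsetP/(_ g gN) gG; have [_ _ hinv _] := hnf.
apply/matrixP => i j.
have := hU gG i; rewrite hinv // => e.
have : 'X_i = \sum_l U g i l *: 'X_l :> {mpoly F[n]}.
  apply: (comp_mpoly_inj hi); rewrite comp_mpolyXU -tnth_nth e linear_sum.
  by apply: eq_bigr => l _; rewrite /= linearZ /= comp_mpolyXU -tnth_nth.
move/(congr1 (mcoeff U_(j)%MM)); rewrite mcoeffX eq_mnm1 raddf_sum (bigD1 j) //=.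
rewrite mcoeffZ mcoeffX eqxx mulr1 big1 ?addr0 => [<-|l lj]; first by rewrite mxE.
by rewrite mcoeffZ mcoeffX eq_mnm1 (negbTE lj) mulr0.
Qed.

(** Each row of P combines basic invariants of one degree, so the change of basis
    gives basic invariants again, now eigenvectors of g. *)
Lemma eigen_invariants g ep de P : g \in G -> joint_eigen (U g) d ep de P ->
  basic_invariants rG N de (lin_tuple P nf) /\
  forall i, poly_act rG g (tnth (lin_tuple P nf) i) =
    ep i *: tnth (lin_tuple P nf) i.
Proof.
move=> gG [Pu PU Pd]; have [_ _ hinv hgen] := hnf; split; last first.
  move=> i; rewrite tnth_mktuple linear_sum scaler_sumr.
  under eq_bigr do rewrite linearZ /= hU // scaler_sumr.
  rewrite exchange_big; apply: eq_bigr => j _.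
  under eq_bigr do rewrite scalerA.
  rewrite -scaler_suml scalerA; congr (_ *: _).
  by have /matrixP/(_ i j) := PU; rewrite mul_diag_mx !mxE.
split.
- move=> i; rewrite tnth_mktuple; apply: rpred_sum => j _.
  have [->|/Pd->] := eqVneq (P i j) 0; first by rewrite scale0r rpred0.
  exact: rpredZ.
- move=> p; rewrite -lin_sub_comp => /hi e.
  by rewrite -[p]lin_sub1 -(mulmxV Pu) -lin_subM e /lin_sub raddf0.
- move=> i y yN; rewrite tnth_mktuple linear_sum; apply: eq_bigr => j _ /=.
  by rewrite linearZ /= hinv.
- move=> h /hgen[p ->]; exists (lin_sub (invmx P) p).
  by rewrite -lin_sub_comp lin_subM mulVmx // lin_sub1.
Qed.

End EigenInvariants.

(** * Projectors onto the multiples of a polynomial *)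

Section ProjectorImage.

Variables (F : numFieldType) (n : nat).
Local Notation S := {mpoly F[n]}.
Variables (d : 'I_n -> nat) (f : n.-tuple S).
Hypotheses (hf : forall i, tnth f i \is (d i).-homog) (fi : alg_independent f).
Variables (J : S) (e : nat) (L : {linear S -> S}).
Hypotheses (J0 : J != 0) (Je : J \is e.-homog).
Hypothesis L_homog : forall k p, p \is k.-homog -> L p \is k.-homog.
Hypothesis L_idem : forall p, L (L p) = L p.
Hypothesis L_J : forall m, L (J * ('X_[m] \mPo f)) = J * ('X_[m] \mPo f).
Hypothesis L_trace : forall k, graded_trace k L =
  if (e <= k)%N then complete_sum (fun=> 1) d (k - e) else 0.

Let d0 i : (0 < d i)%N. Proof. exact: degree_gt0 fi _ (hf i). Qed.

Lemma sum_by_degree m (G : 'X_{1..n} -> F) :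
  \sum_(a : 'X_{1..n < m}) G a =
  \sum_(k < m) \sum_(a : 'X_{1..n < k.+1} | mdeg a == k) G a.
Proof.
have degE (a : 'X_{1..n}) : mdeg a = wdeg (fun=> 1%N) a.
  by rewrite mdegE; apply: eq_bigr => i _; rewrite muln1.
rewrite (partition_big (fun a : 'X_{1..n < m} => Ordinal (bmdeg a)) predT) //=.
apply: eq_bigr => k _.
transitivity (\sum_(a : 'X_{1..n < m} | wdeg (fun=> 1%N) a == k) G a).
  by apply: eq_bigl => a; rewrite -degE -val_eqE.
rewrite sum_bmnm_bound //; apply: eq_bigl => a; by rewrite -degE.
Qed.

Section Truncated.

Variable m : nat.
Local Notation I := ('X_{1..n < m}).

Definition trunc_vec (p : S) : 'rV[F]_#|{: I}| := \row_a p@_(enum_val a : I).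

Definition trunc_mx : 'M[F]_#|{: I}| :=
  \matrix_a trunc_vec (L 'X_[(enum_val a : I)]).

Lemma trunc_vec_is_linear : linear trunc_vec.
Proof. by move=> c p q; apply/rowP => a; rewrite !mxE mcoeffD mcoeffZ. Qed.

HB.instance Definition _ := GRing.isLinear.Build F S 'rV[F]_#|{: I}| _
  trunc_vec trunc_vec_is_linear.

Lemma trunc_vecK p : (msize p <= m)%N ->
  p = \sum_a trunc_vec p 0 a *: 'X_[(enum_val a : I)].
Proof.
move=> pm; rewrite {1}(mpolywE pm).
rewrite (reindex_onto (enum_val : 'I_#|{: I}| -> I) enum_rank) => [|a _]; last first.
  exact: enum_rankK.
by apply: eq_big => [a|a _]; rewrite ?enum_valK ?eqxx // mxE.
Qed.

Lemma trunc_mxE p : (msize p <= m)%N -> trunc_vec p *m trunc_mx = trunc_vec (L p).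
Proof.
move=> pm; rewrite {2}(trunc_vecK pm) !linear_sum mulmx_sum_row /=.
by apply: eq_bigr => a _; rewrite !linearZ /= rowK.
Qed.

Lemma msize_L_monomial (a : I) : (msize (L 'X_[a]) <= m)%N.
Proof.
apply: leq_trans (msize_homog (L_homog (_ : _ \is (mdeg a).-homog))) (bmdeg a).
by rewrite dhomogX.
Qed.

Lemma trunc_mx_idem : trunc_mx *m trunc_mx = trunc_mx.
Proof.
apply/row_matrixP => a; rewrite row_mul !rowK trunc_mxE ?L_idem //.
exact: msize_L_monomial.
Qed.

(** The exponents b for which J f^b has degree less than m. *)
Definition low_exponents : {set I} := [set b : I | (e + wdeg d b < m)%N].

Lemma trunc_mx_trace : \tr trunc_mx = #|low_exponents|%:R.
Proof.
have -> : \tr trunc_mx = \sum_(a : I) (L 'X_[a])@_a.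
  rewrite (reindex_onto (enum_val : 'I_#|{: I}| -> I) enum_rank) => [|a _]; last first.
    exact: enum_rankK.
  by apply: eq_big => [a|a _]; rewrite ?enum_valK ?eqxx // !mxE.
rewrite (sum_by_degree m (fun a => (L 'X_[a])@_a)).
rewrite -sum1_card natr_sum.
rewrite (eq_bigr (fun k : 'I_m =>
   \sum_(b : I | (e + wdeg d b == k)%N) 1)) => [|k _]; last first.
  rewrite -[LHS]/(graded_trace k L) L_trace; case: leqP => [ek|ke]; last first.
    rewrite big_pred0 // => b; apply/negbTE; rewrite neq_ltn orbC.
    by rewrite (leq_trans ke) ?leq_addr.
  rewrite /complete_sum.
  rewrite -(@sum_bmnm_bound n d _ (fun b => \prod_(i < n) 1 ^+ b i) (k - e) m) //.
    apply: eq_big => [b|b _]; first by rewrite -{2}(subnKC ek) eqn_add2l.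
    by rewrite big1 // => i _; rewrite expr1n.
  exact: leq_ltn_trans (leq_subr _ _) (ltn_ord k).
rewrite (exchange_big_dep predT) //= [RHS]big_mkcond; apply: eq_bigr => b _.
rewrite inE; case: ltnP => [bm|mb].
  rewrite (big_pred1 (Ordinal bm)) //.
rewrite big_pred0 // => k; apply/negbTE; rewrite neq_ltn orbC.
by rewrite (leq_trans (ltn_ord k)).
Qed.

Definition low_mx : 'M[F]_(#|low_exponents|, #|{: I}|) :=
  \matrix_b trunc_vec (J * ('X_[(enum_val b : I)] \mPo f)).

Lemma msize_low (b : I) : b \in low_exponents ->
  (msize (J * ('X_[b] \mPo f)) <= m)%N.
Proof.
rewrite inE; apply: leq_trans; apply: msize_homog.
by apply: dhomogM => //; apply: dhomog_comp_monomial.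
Qed.

Lemma low_mx_mul (v : 'rV[F]_#|low_exponents|) :
  v *m low_mx = trunc_vec (J * ((\sum_b v 0 b *: 'X_[(enum_val b : I)]) \mPo f)).
Proof.
rewrite linear_sum mulr_sumr linear_sum mulmx_sum_row; apply: eq_bigr => b _ /=.
by rewrite linearZ /= -scalerAr linearZ rowK.
Qed.

Lemma low_mx_free : row_free low_mx.
Proof.
rewrite -kermx_eq0; apply/rowV0P => v /sub_kermxP; rewrite low_mx_mul => h.
set q := \sum_b _ in h.
have qm : (msize (J * (q \mPo f)) <= m)%N.
  rewrite /q linear_sum mulr_sumr; apply: leq_trans (msize_sum _ _ _) _.
  apply/bigmax_leqP => b _; rewrite /= linearZ /= -scalerAr.
  by apply: leq_trans (msizeZ_le _ _) (msize_low (enum_valP b)).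
have q0 : q = 0.
  apply: (comp_mpoly_inj fi); apply: (mulfI J0).
  rewrite raddf0 mulr0 (trunc_vecK qm) h big1 // => a _.
  by rewrite mxE scale0r.
apply/rowP => b; rewrite mxE.
have /(congr1 (mcoeff (enum_val b : I))) := q0.
rewrite mcoeff0 /q raddf_sum (bigD1 b) //= mcoeffZ mcoeffX eqxx mulr1.
rewrite big1 ?addr0 // => c cb; rewrite mcoeffZ mcoeffX.
case: eqP => [/val_inj/enum_val_inj cb'|]; last by rewrite mulr0.
by rewrite cb' eqxx in cb.
Qed.

(** The polynomials J f^b are fixed by L and independent, so they span a subspace
    of the image of L. It is the whole image because the rank of the idempotent
    trunc_mx is its trace, which is the number of these polynomials. *)
Lemma sub_low_mx : (trunc_mx <= low_mx)%MS.
Proof.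
have le : (low_mx <= trunc_mx)%MS.
  apply/row_subP => b; rewrite rowK.
  have -> : trunc_vec (J * ('X_[(enum_val b : I)] \mPo f))
      = trunc_vec (J * ('X_[(enum_val b : I)] \mPo f)) *m trunc_mx.
    by rewrite trunc_mxE ?L_J // msize_low // enum_valP.
  exact: submxMl.
rewrite -(mxrank_leqif_sup le) eqn_leq mxrankS //=.
have /eqP -> : row_free low_mx := low_mx_free.
by rewrite -(ler_nat F) -idempotent_mxtrace ?trunc_mx_idem // trunc_mx_trace.
Qed.

End Truncated.

(** L_J puts J F[f] in the image of the projector L, and L_trace makes the
    dimensions agree in each degree. *)
Lemma projector_image h : L h = h -> exists p, h = J * (p \mPo f).
Proof.
move=> Lh; pose m := msize h.
have : (trunc_vec m h <= low_mx m)%MS.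
  apply: submx_trans (sub_low_mx m); rewrite -{1}Lh -trunc_mxE //.
  exact: submxMl.
case/submxP => v; rewrite low_mx_mul; set q := \sum_b _ => hq.
exists q; rewrite (trunc_vecK (leqnn (msize h))) -/m hq -trunc_vecK //.
rewrite /q linear_sum mulr_sumr; apply: leq_trans (msize_sum _ _ _) _.
apply/bigmax_leqP => b _; rewrite /= linearZ /= -scalerAr.
by apply: leq_trans (msizeZ_le _ _) (msize_low (enum_valP b)).
Qed.

End ProjectorImage.

(** * Spectral polynomials and their limits at 1 *)

Lemma horner_spectral_poly (F : numFieldType) n (ep : 'I_n -> F) d x :
  (spectral_poly ep d).[x] = \prod_i (1 - ep i * x ^+ d i).
Proof.
rewrite /spectral_poly horner_prod; apply: eq_bigr => i _.
by rewrite hornerD hornerN hornerZ hornerXn hornerC.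
Qed.

Lemma spectral_poly_neq0 (F : numFieldType) n (ep : 'I_n -> F) d x :
    (forall i, `|ep i| = 1) -> (forall i, 0 < d i)%N -> `|x| != 1 ->
  (spectral_poly ep d).[x] != 0.
Proof.
move=> ep1 d0 x1; rewrite horner_spectral_poly; apply/prodf_neq0 => i _.
apply: contraNneq x1 => /eqP; rewrite subr_eq0 => /eqP e.
have : `|ep i * x ^+ d i| = 1 by rewrite -e normr1.
by rewrite normrM ep1 mul1r normrX => /eqP; rewrite pexpr_eq1 // => /eqP->.
Qed.

(** The determinants of A (1 - B D') D = A D - 1, where B and D' are the inverses
    of A and D: the source of the symmetry T -> 1/T of Molien series. *)
Lemma det_one_sub_inv (F : fieldType) n (A B D D' : 'M[F]_n) :
    A *m B = 1%:M -> D' *m D = 1%:M ->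
  \det A * \det (1%:M - B *m D') * \det D = (-1) ^+ n * \det (1%:M - A *m D).
Proof.
move=> AB DD; rewrite -!det_mulmx -detZ mulmxBr mulmx1 mulmxA AB mul1mx mulmxBl DD.
by rewrite scaleN1r opprB.
Qed.

Lemma joint_eigen_norm (F : numFieldType) (gT : finGroupType) (G : {group gT}) n
    (U : mx_representation F G n) d g ep de P :
  g \in G -> joint_eigen (U g) d ep de P -> forall i, `|ep i| = 1.
Proof.
move=> gG [Pu PU _] i.
have PX k : P *m U (g ^+ k)%g = diag_mx (\row_i ep i ^+ k) *m P.
  elim: k => [|k IH].
    rewrite expg0 repr_mx1 mulmx1; apply/matrixP => a b.
    by rewrite mul_diag_mx !mxE expr0 mul1r.
  rewrite expgS repr_mxM ?groupX // mulmxA PU -mulmxA IH mulmxA mulmx_diag.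
  by congr (diag_mx _ *m _); apply/rowP => a; rewrite !mxE exprS.
have : diag_mx (\row_i ep i ^+ #[g]%g) = 1%:M :> 'M[F]_n.
  apply: (row_free_inj (_ : row_free P)); first by rewrite row_free_unit.
  by rewrite -PX expg_order repr_mx1 mulmx1 mul1mx.
move/matrixP/(_ i i); rewrite !mxE eqxx mulr1n => e1.
apply/eqP; rewrite -(pexpr_eq1 (n := #[g]%g)) ?order_gt0 //.
by rewrite -normrX e1 normr1.
Qed.

Lemma det_neq0_perm (R : comNzRingType) n (M : 'M[R]_n) :
  \det M != 0 -> exists s : 'S_n, forall j, M j (s j) != 0.
Proof.
move=> h; apply/not_existsP => hs; case/eqP: h; apply: big1 => s _.
have /existsNP[j /negP/negPn/eqP Mj] := hs s.
by rewrite (bigD1 j) //= Mj mul0r mulr0.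
Qed.

Section LimitAtOne.

Variables (F : numFieldType) (n : nat).
Variables (ep : 'I_n -> F) (d E : 'I_n -> nat) (c : 'I_n -> F).

(** The quotients of 1 + ep (c (1 - T) - 1) T^E by 1 - ep T^d, in lowest terms at
    T = 1: for ep = 1 both are divisible by 1 - T, and the quotients by 1 - T are
    the factors of limit_num and limit_den. For ep != 1 nothing vanishes at 1. *)
Definition limit_num : {poly F} := \prod_i
  (if ep i == 1 then \sum_(l < E i) 'X^l + c i *: 'X^(E i)
   else 1 - ep i *: 'X^(E i) + (ep i * c i) *: ((1 - 'X) * 'X^(E i))).

Definition limit_den : {poly F} := \prod_i
  (if ep i == 1 then \sum_(l < d i) 'X^l else 1 - ep i *: 'X^(d i)).

Lemma geometric_sum (x : F) m : x != 1 ->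
  \sum_(l < m) x ^+ l = (1 - x ^+ m) / (1 - x).
Proof.
move=> x1; have x1' : 1 - x != 0 by rewrite subr_eq0 eq_sym.
by apply: (mulIf x1'); rewrite divfK // -[RHS]opprB subrX1 -mulNr opprB mulrC.
Qed.

Lemma horner_geometric m (x : F) : (\sum_(l < m) 'X^l).[x] = \sum_(l < m) x ^+ l.
Proof. by rewrite horner_sum; apply: eq_bigr => l _; rewrite hornerXn. Qed.

Lemma limit_den_neq0 x : x != 1 -> (spectral_poly ep d).[x] != 0 ->
  limit_den.[x] != 0.
Proof.
move=> x1; rewrite horner_spectral_poly horner_prod => /prodf_neq0 h.
apply/prodf_neq0 => i _; have := h i isT; case: (eqVneq (ep i) 1) => [->|_].
  rewrite mul1r horner_geometric geometric_sum // => h1.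
  by rewrite mulf_neq0 // invr_neq0 // subr_eq0 eq_sym.
by rewrite hornerD hornerN hornerZ hornerXn hornerC.
Qed.

Lemma limit_ratio x : x != 1 -> (spectral_poly ep d).[x] != 0 ->
  limit_num.[x] / limit_den.[x] =
  (\prod_i (1 + (ep i * (c i * (1 - x) - 1)) * x ^+ E i)) / (spectral_poly ep d).[x].
Proof.
move=> x1; have x1' : 1 - x != 0 by rewrite subr_eq0 eq_sym.
rewrite horner_spectral_poly => /prodf_neq0 h.
rewrite !horner_prod -!prodf_div; apply: eq_bigr => i _; have := h i isT.
case: (eqVneq (ep i) 1) => [->|_ hi].
  rewrite !mul1r hornerD hornerZ hornerXn !horner_geometric !geometric_sum // => hi.
  by field; rewrite x1' hi.
congr (_ / _); rewrite ?(hornerD, hornerN, hornerZ, hornerM, hornerXn, hornerC, hornerX).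
  by ring.
by [].
Qed.

Lemma limit_den1_neq0 : (forall i, 0 < d i)%N -> limit_den.[1] != 0.
Proof.
move=> d0; rewrite horner_prod; apply/prodf_neq0 => i _.
case: (eqVneq (ep i) 1) => [_|ep1].
  rewrite horner_geometric; under eq_bigr do rewrite expr1n.
  by rewrite sumr_const card_ord pnatr_eq0 -lt0n.
by rewrite hornerD hornerN hornerZ hornerXn hornerC expr1n mulr1 subr_eq0 eq_sym.
Qed.

Lemma limit_ratio1 : limit_num.[1] / limit_den.[1] =
  \prod_i (if ep i == 1 then (c i + (E i)%:R) / (d i)%:R else 1).
Proof.
rewrite !horner_prod -prodf_div; apply: eq_bigr => i _; case: eqP => [_|/eqP ep1].
  rewrite hornerD hornerZ hornerXn !horner_geometric expr1n mulr1 addrC.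
  under eq_bigr do rewrite expr1n; under [X in _ / X]eq_bigr do rewrite expr1n.
  by rewrite !sumr_const !card_ord.
rewrite !(hornerD, hornerN, hornerZ, hornerM, hornerXn, hornerC, hornerX) expr1n.
by rewrite subrr mul0r mulr0 addr0 !expr1n mulr1 divff // subr_eq0 eq_sym.
Qed.

End LimitAtOne.

(** * Semi-invariants and traces for a pair of subgroups *)

Section OrbitPair.

(** The pairs N \subset K of interest are the trivial group inside an orbit
    subgroup, and an orbit subgroup inside G. Sums run over cosets ga K, because
    the first pair is needed on the cosets of the orbit subgroup. *)
Variables (F : numFieldType) (gT : finGroupType) (G K N : {group gT}).
Hypotheses (KG : K \subset G) (NK : N \subset K).
Variables (n : nat) (rG : mx_representation F G n).
Local Notation S := {mpoly F[n]}.

Variables (d : 'I_n -> nat) (nf : n.-tuple S).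
Hypothesis hnf : basic_invariants rG N d nf.
Variable U : mx_representation F G n.
Hypothesis hU : {in G, forall g i,
  poly_act rG g (tnth nf i) = \sum_j U g i j *: tnth nf j}.
Variables (D : 'I_n -> nat) (f : n.-tuple S).
Hypothesis hf : basic_invariants rG K D f.
Variables (ep : gT -> 'I_n -> F) (de : gT -> 'I_n -> nat).
Hypothesis hed : {in G, forall g, exists P, joint_eigen (U g) d (ep g) (de g) P}.

Let NG : N \subset G := subset_trans NK KG.
Let nf_homog i : tnth nf i \is (d i).-homog. Proof. by case: hnf. Qed.
Let nf_indep : alg_independent nf. Proof. by case: hnf. Qed.
Let f_homog i : tnth f i \is (D i).-homog. Proof. by case: hf. Qed.
Let f_indep : alg_independent f. Proof. by case: hf. Qed.
Let D_gt0 i : (0 < D i)%N. Proof. exact: degree_gt0 f_indep _ (f_homog i). Qed.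

Lemma de_gt0 g i : g \in G -> (0 < de g i)%N.
Proof.
move=> gG; have [P hP] := hed gG.
have [[hh hi _ _] _] := eigen_invariants hnf hU gG hP.
exact: degree_gt0 hi _ (hh i).
Qed.

Lemma ep_norm g i : g \in G -> `|ep g i| = 1.
Proof. by move=> gG; have [P hP] := hed gG; apply: joint_eigen_norm gG hP i. Qed.

Definition spectral g := spectral_poly (ep g) (de g).

Lemma spectral_neq0 g x : g \in G -> `|x| != 1 -> (spectral g).[x] != 0.
Proof.
move=> gG; apply: spectral_poly_neq0 => i; [exact: ep_norm | exact: de_gt0].
Qed.

Lemma spectral_det g x : g \in G ->
  (spectral g).[x] = \det (1%:M - U g *m diag_mx (\row_i x ^+ d i)).
Proof.
move=> gG; have [P hP] := hed gG; rewrite horner_spectral_poly.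
have := joint_eigen_det hP (fun=> 1) (fun k => - x ^+ k).
rewrite (eq_bigr (fun i => 1 - ep g i * x ^+ de g i)) => [<-|i _]; last first.
  by rewrite mulrN.
congr (\det _); apply/matrixP => a b; rewrite !mul_mx_diag !mxE mulrN.
by [].
Qed.

Lemma inverse_series_spectral g : g \in G ->
  inverse_series (complete_sum (ep g) (de g)) (spectral g).
Proof.
by move=> gG; apply: inverse_series_complete_sum => i; apply: de_gt0.
Qed.

Lemma molien_coset_eigen g k : g \in G ->
  \sum_(y in N) graded_trace k (poly_act rG (g * y)%g)
    = #|N|%:R * complete_sum (ep g) (de g) k.
Proof.
move=> gG; have [P hP] := hed gG.
have [hb he] := eigen_invariants hnf hU gG hP.
exact: (molien_coset NG hb k gG he).
Qed.

(** By molien_coset_eigen each complete sum is the mean of the traces over a coset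
    of N, on which c is constant; these means have the same sum over K as the
    traces themselves. *)
Lemma class_sum_traces (c : gT -> F) ga k : ga \in G ->
    {in G & N, forall g y, c (g * y)%g = c g} ->
  \sum_(x in K) c (ga * x)%g * complete_sum (ep (ga * x)) (de (ga * x)) k =
  \sum_(x in K) c (ga * x)%g * graded_trace k (poly_act rG (ga * x)%g).
Proof.
move=> gaG hc; have N0 : #|N|%:R != 0 :> F by rewrite pnatr_eq0 -lt0n cardG_gt0.
apply: (mulfI N0); rewrite mulr_sumr.
transitivity (\sum_(x in K) \sum_(y in N)
    c (ga * (x * y))%g * graded_trace k (poly_act rG (ga * (x * y))%g)).
  apply: eq_bigr => x xK; have xG := subsetP KG x xK.
  rewrite mulrCA -molien_coset_eigen ?groupM // mulr_sumr.
  by apply: eq_bigr => y yN; rewrite mulgA (hc (ga * x)%g y) ?groupM.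
rewrite exchange_big -sum1_card natr_sum mulr_suml; apply: eq_bigr => y yN.
rewrite mul1r [RHS](reindex_inj (mulIg y)) /=.
by apply: eq_bigl => x; rewrite groupMr // (subsetP NK).
Qed.

(** The left side is the Molien series of K computed coset by coset with the basic
    invariants of N, the right side with those of K. *)
Lemma molien_values x : `|x| != 1 ->
  \sum_(g in K) (spectral g).[x]^-1 =
    #|K|%:R / (spectral_poly (fun=> 1) D).[x].
Proof.
move=> x1.
have hsp : {in K, forall g, inverse_series (complete_sum (ep g) (de g)) (spectral g)}.
  by move=> g gK; apply/inverse_series_spectral/(subsetP KG).
have hD : inverse_series (complete_sum (fun=> 1) D) (spectral_poly (fun=> 1 : F) D).
  exact: inverse_series_complete_sum.
have : cleared K (fun=> 1%:P) spectral #|K|%:R%:P (spectral_poly (fun=> 1) D) = 0.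
  apply/(cleared_eq0_coef _ _ hsp hD) => k.
  rewrite [RHS]big_ord_recl subn0 coefC eqxx [X in _ + X]big1 ?addr0 => [|j _]; last first.
    by rewrite coefC mul0r.
  rewrite -(@molien_coset _ _ _ _ _ _ _ _ KG hf 1%g) ?group1 // => [|j]; last first.
    by rewrite poly_act1 scale1r.
  have := @class_sum_traces (fun=> 1) 1%g k (group1 _) (fun _ _ _ _ => erefl).
  rewrite (eq_bigr (fun g => 1 * complete_sum (ep g) (de g) k)) => [->|g _].
    by apply: eq_bigr => g _; rewrite mul1r.
  by rewrite mul1g.
move/(congr1 (fun p : {poly F} => p.[x])); rewrite horner0 => /eqP.
rewrite cleared_eq0 => [/eqP e||]; last first.
- by apply: spectral_poly_neq0 => // i; rewrite normr1.
- by move=> g gK; rewrite spectral_neq0 // (subsetP KG).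
rewrite -[#|K|%:R](hornerC _ x) -e; apply: eq_bigr => g _.
by rewrite hornerC mul1r.
Qed.

Lemma orbit_action_inv g : g \in G -> U g *m U g^-1%g = 1%:M.
Proof. by move=> gG; rewrite -repr_mxM ?groupV // mulgV repr_mx1. Qed.

(** This is molien_values at 1/x: inverting x and g changes det (1 - U_g D_x) by
    the factor (-1)^n / (det U_g det D_x), where D_x = diag (x^(d i)). *)
Lemma molien_det_values x E : (\sum_i D i = E + \sum_i d i)%N ->
    x != 0 -> `|x| != 1 ->
  \sum_(g in K) \det (U g) / (spectral g).[x] =
    #|K|%:R * x ^+ E / (spectral_poly (fun=> 1) D).[x].
Proof.
move=> hE x0 x1.
have xV1 : `|x^-1| != 1 by rewrite normfV invr_eq1.
pose Dx := diag_mx (\row_i x ^+ d i) : 'M[F]_n.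
pose Dx' := diag_mx (\row_i x^-1 ^+ d i) : 'M[F]_n.
have DD : Dx' *m Dx = 1%:M.
  rewrite mulmx_diag -scalemx1 -diag_const_mx scale1r; congr diag_mx.
  by apply/rowP => i; rewrite !mxE -exprMn mulVf // expr1n.
have detD : \det Dx = x ^+ (\sum_i d i).
  rewrite det_diag -prodrXr; apply: eq_bigr => i _; by rewrite mxE.
have term g : g \in K ->
    \det (U g) / (spectral g).[x] =
      (-1) ^+ n / x ^+ (\sum_i d i) * (spectral g^-1%g).[x^-1]^-1.
  move=> gK; have gG := subsetP KG g gK.
  have s1 := spectral_neq0 gG x1; have s2 := spectral_neq0 (groupVr gG) xV1.
  have := det_one_sub_inv (orbit_action_inv gG) DD.
  rewrite -!spectral_det ?groupV // detD => e.
  have xd0 : x ^+ (\sum_i d i) != 0 by rewrite expf_neq0.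
  apply: (mulIf s1); rewrite divfK //; apply: (mulIf s2); apply: (mulIf xd0).
  by rewrite e; field; rewrite xd0 s2.
rewrite (eq_bigr _ term) -mulr_sumr.
have -> : \sum_(g in K) (spectral g^-1%g).[x^-1]^-1 =
    \sum_(g in K) (spectral g).[x^-1]^-1.
  rewrite [RHS](reindex_inj invg_inj); apply: eq_bigl => g; by rewrite groupV.
rewrite molien_values //.
have -> : (spectral_poly (fun=> 1) D).[x^-1] =
    (-1) ^+ n * (spectral_poly (fun=> 1) D).[x] / x ^+ (\sum_i D i).
  rewrite !horner_spectral_poly -prodrXr -prodfV.
  have -> : (-1) ^+ n = \prod_(i < n) (-1) :> F by rewrite prodr_const card_ord.
  rewrite -!big_split; apply: eq_bigr => i _ /=.
  have xD0 : x ^+ D i != 0 by rewrite expf_neq0.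
  by rewrite exprVn; field.
have sD0 : (spectral_poly (fun=> 1) D).[x] != 0.
  by apply: spectral_poly_neq0 => // i; rewrite normr1.
rewrite hE exprD; set y := x ^+ _; set z := x ^+ _; set s := (-1) ^+ n.
have s0 : s != 0 by rewrite signr_eq0.
have z0 : z != 0 by rewrite expf_neq0.
have y0 : y != 0 by rewrite expf_neq0.
by field; rewrite sD0 y0 z0 s0.
Qed.

(** By the chain rule the Jacobian of f is that of the Fp j with respect to the
    invariants nf, times the Jacobian of nf; so the former is nonzero, and
    det_row_blocks keeps one degree in each row. *)
Lemma orbit_forms_exist : exists (Fp : 'I_n -> S) (b : 'I_n -> nat),
  (forall j, tnth f j = Fp j \mPo nf) /\
  \det (\matrix_(j, i) (if d i == b j then (Fp j)^`M(i) \mPo nf else 0)) != 0.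
Proof.
have [_ _ _ nf_gen] := hnf; have [_ _ f_inv _] := hf.
have inv j : poly_invariant rG N (tnth f j).
  by move=> y yN; apply: f_inv; apply: (subsetP NK).
have [Fp hFp] := fin_all_exists (fun j => nf_gen _ (inv j)).
pose M : 'M[S]_n := \matrix_(j, i) ((Fp j)^`M(i) \mPo nf).
have M0 : \det M != 0.
  have := jacobian_neq0 KG hf.
  have -> : jacobian f = M *m jacobian nf.
    apply/matrixP => j i; rewrite !mxE hFp mderiv_comp.
    by apply: eq_bigr => l _; rewrite !mxE.
  by apply: contraNneq => M0; rewrite det_mulmx M0 mul0r.
have [b hb] := det_row_blocks d M0; exists Fp, b; split; first exact: hFp.
have -> // : \matrix_(j, i) (if d i == b j then (Fp j)^`M(i) \mPo nf else 0) =
    \matrix_(j, i) (if d i == b j then M j i else 0).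
by apply/matrixP => j i; rewrite !mxE.
Qed.

Variables (Fp : 'I_n -> S) (b : 'I_n -> nat).
Hypothesis hFp : forall j, tnth f j = Fp j \mPo nf.

(** Row j is the part of the differential of Fp j along the invariants nf i of
    degree b j. *)
Definition orbit_forms : 'M[S]_n :=
  \matrix_(j, i) (if d i == b j then (Fp j)^`M(i) \mPo nf else 0).
Local Notation Om := orbit_forms.
Local Notation J := (\det orbit_forms).

Hypothesis J_neq0 : J != 0.

Let Fp_homog j : Fp j \mPo nf \is (D j).-homog.
Proof. by rewrite -hFp. Qed.

Lemma orbit_forms_homog j i : Om j i \is (D j - b j)%N.-homog.
Proof.
rewrite mxE; case: eqP => [<-|_]; last exact: rpred0.
exact: mderiv_weighted nf_homog nf_indep _ _ _ (Fp_homog j).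
Qed.

Lemma block_perm : exists2 s : 'S_n, forall j, b j = d (s j)
  & forall j, (b j <= D j)%N.
Proof.
have [s hs] := det_neq0_perm J_neq0.
have ds j : d (s j) = b j.
  by apply/eqP; have := hs j; rewrite mxE; case: ifP; rewrite ?eqxx.
exists s => j; first by rewrite ds.
have := hs j; rewrite mxE ds eqxx -ds => F0.
apply: (mderiv_weighted_leq nf_homog nf_indep (Fp_homog j)).
by apply: contraNneq F0 => ->; rewrite raddf0.
Qed.

(** The degree of J is the difference of the sums of the degrees, which is the
    exponent needed in molien_det_values. *)
Lemma block_sum : (\sum_j D j = \sum_j (D j - b j) + \sum_i d i)%N.
Proof.
have [s hs bD] := block_perm; rewrite [X in (_ + X)%N](reindex_inj (@perm_inj _ s)).
by rewrite -big_split; apply: eq_bigr => j _; rewrite /= -hs subnK.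
Qed.

(** The derivatives of the relation Fp j (U_g nf) = e0 j Fp j (nf). Since U_g
    preserves degrees, they are compatible with the restriction to the columns of
    one degree. *)
Lemma orbit_forms_equivariant g e0 : g \in G ->
    (forall j, poly_act rG g (tnth f j) = e0 j *: tnth f j) ->
  map_mx (poly_act rG g) Om *m map_mx (mpolyC n (R := F)) (U g)
    = \matrix_(j, l) (e0 j *: Om j l).
Proof.
move=> gG he; apply/matrixP => j l; rewrite !mxE.
have hF : lin_sub (U g) (Fp j) = e0 j *: Fp j.
  apply: (comp_mpoly_inj nf_indep).
  by rewrite -(poly_act_lin_sub hU (Fp j) gG) -hFp he [RHS]linearZ /= -hFp.
have hd i : d i != d l -> U g i l = 0.
  move=> dil; apply/eqP; apply: contraNT dil.
  by move=> /(orbit_action_block hnf hU gG) ->.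
have key : \sum_i poly_act rG g ((Fp j)^`M(i) \mPo nf) * (U g i l)%:MP
    = e0 j *: ((Fp j)^`M(l) \mPo nf).
  have T i : (tnth (lin_tuple (U g) [tuple 'X_m | m < n]) i)^`M(l) = (U g i l)%:MP.
    rewrite tnth_mktuple linear_sum (bigD1 l) //= tnth_mktuple mderivZ mderiv_var.
    rewrite eqxx -mul_mpolyC mulr1 big1 ?addr0 // => m ml.
    by rewrite tnth_mktuple mderivZ mderiv_var (negbTE ml) scaler0.
  have := congr1 (fun p => p^`M(l) \mPo nf) hF.
  rewrite /= mderivZ /= mderiv_comp linear_sum linearZ /= => <-.
  apply: eq_bigr => i _.
  by rewrite rmorphM /= T comp_mpolyC (poly_act_lin_sub hU _ gG).
have [dl|dl] := eqVneq (d l) (b j); last first.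
  rewrite scaler0 big1 // => i _; rewrite !mxE.
  have [di|_] := eqVneq (d i) (b j); last by rewrite raddf0 mul0r.
  by rewrite hd ?mpolyC0 ?mulr0 // di eq_sym.
rewrite -key; apply: eq_bigr => i _; rewrite !mxE.
have [//|di] := eqVneq (d i) (b j).
by rewrite hd ?mpolyC0 ?mulr0 // dl.
Qed.

Lemma orbit_forms_det g e0 : g \in G ->
    (forall j, poly_act rG g (tnth f j) = e0 j *: tnth f j) ->
  \det (U g) *: poly_act rG g J = (\prod_j e0 j) *: J.
Proof.
move=> gG he; have := congr1 determinant (orbit_forms_equivariant gG he).
rewrite det_mulmx !det_map_mx mulrC mul_mpolyC => ->.
have -> : (\matrix_(j, l) (e0 j *: Om j l)) = diag_mx (\row_j (e0 j)%:MP) *m Om.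
  by apply/matrixP => j l; rewrite mul_diag_mx !mxE mul_mpolyC.
rewrite det_mulmx det_diag -mul_mpolyC rmorph_prod; congr (_ * _).
by apply: eq_bigr => j _; rewrite mxE.
Qed.

(** Multiplying row j by v (b j) amounts to multiplying column l by v (d l), as
    orbit_forms vanishes unless d l = b j. By equivariance the matrix on the left
    is then the product of the transform of orbit_forms by g and of
    1 + U_g diag (v (d i)). *)
Lemma orbit_forms_twist g e0 (v : nat -> F) : g \in G ->
    (forall j, poly_act rG g (tnth f j) = e0 j *: tnth f j) ->
  \det (U g) *: \det (\matrix_(j, l)
      (poly_act rG g (Om j l) + (e0 j * v (b j)) *: Om j l)) =
  (\det (1%:M + U g *m diag_mx (\row_i v (d i))) * \prod_j e0 j) *: J.
Proof.
move=> gG he; pose C := mpolyC n (R := F).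
have -> : (\matrix_(j, l) (poly_act rG g (Om j l) + (e0 j * v (b j)) *: Om j l))
  = map_mx (poly_act rG g) Om
      *m map_mx C (1%:M + U g *m diag_mx (\row_i v (d i))).
  rewrite map_mxD map_mx1 mulmxDr mulmx1 map_mxM mulmxA.
  rewrite (orbit_forms_equivariant gG he) map_diag_mx.
  apply/matrixP => j l; rewrite mul_mx_diag !mxE; congr (_ + _).
  rewrite -!mul_mpolyC mulrAC -rmorphM /=.
  by case: eqP => [->|_]; rewrite ?mulr0.
rewrite det_mulmx !det_map_mx [_ * C _]mulrC mul_mpolyC scalerA.
by rewrite [\det (U g) * _]mulrC -[LHS]scalerA /= (orbit_forms_det gG he) scalerA.
Qed.

Let E := (\sum_j (D j - b j))%N.

Let J_homog : J \is E.-homog.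
Proof. exact: dhomog_det orbit_forms_homog. Qed.

Lemma orbit_forms_det_inv x : x \in K -> \det (U x) *: poly_act rG x J = J.
Proof.
move=> xK; rewrite (@orbit_forms_det _ (fun=> 1)) ?(subsetP KG) //.
  by rewrite big1 // scale1r.
by move=> j; rewrite scale1r; case: hf => _ _ ->.
Qed.

Lemma orbit_det_class : {in G & N, forall g y, \det (U (g * y)%g) = \det (U g)}.
Proof.
move=> g y gG yN; rewrite repr_mxM ?(subsetP NG y yN) // det_mulmx.
by rewrite (orbit_action1 hnf hU yN NG) det1 mulr1.
Qed.

(** The coefficients of the rational functions of molien_det_values: the
    dimensions of the spaces of semi-invariants, up to the factor #|K|. *)
Lemma det_traces k :
  \sum_(x in K) \det (U x) * complete_sum (ep x) (de x) k =
  if (E <= k)%N then #|K|%:R * complete_sum (fun=> 1) D (k - E) else 0.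
Proof.
have hsp : {in K, forall g, inverse_series (complete_sum (ep g) (de g)) (spectral g)}.
  by move=> g gK; apply/inverse_series_spectral/(subsetP KG).
have hD : inverse_series (complete_sum (fun=> 1) D) (spectral_poly (fun=> 1 : F) D).
  exact: inverse_series_complete_sum.
have cl : cleared K (fun x => (\det (U x))%:P) spectral (#|K|%:R *: 'X^E)
    (spectral_poly (fun=> 1) D) = 0.
  apply: poly_eq0_nat => l; set x := l.+2%:R.
  have x0 : x != 0 by rewrite pnatr_eq0.
  have x1 : `|x| != 1 by rewrite normr_nat (eqr_nat F _ 1).
  apply/eqP; rewrite cleared_eq0 => [|g gK|].
  - rewrite hornerZ hornerXn -(molien_det_values block_sum) //.
    by apply/eqP; apply: eq_bigr => g _; rewrite hornerC.
  - by rewrite spectral_neq0 // (subsetP KG).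
  - by apply: spectral_poly_neq0 => // i; rewrite normr1.
have /(cleared_eq0_coef _ _ hsp hD)/(_ k) -> := cl.
have [Ek|kE] := leqP E k.
  have Ek' : (E < k.+1)%N by [].
  rewrite (bigD1 (Ordinal Ek')) //= coefZ coefXn eqxx mulr1 big1 ?addr0 // => j jE.
  rewrite coefZ coefXn (_ : (_ == E) = false) ?mulr0 ?mul0r //.
  by apply: contraNF jE => /eqP jE; apply/eqP/val_inj.
rewrite big1 // => j _; rewrite coefZ coefXn (_ : (_ == E) = false) ?mulr0 ?mul0r //.
by apply/negbTE; rewrite neq_ltn (leq_ltn_trans _ kE) // -ltnS.
Qed.

Lemma coset_act_semi_invariant c ga h : ga \in G ->
    {in G & K, forall g x, c (g * x)%g = c g * \det (U x)} ->
  {in K, forall x, \det (U x) *: poly_act rG x (coset_act rG K c ga h)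
    = coset_act rG K c ga h}.
Proof.
move=> gaG hc x xK; rewrite (poly_act_coset_act rG c h KG gaG xK) /coset_act scaler_sumr.
rewrite [RHS](reindex_inj (mulIg x)) /=.
apply: eq_big => [y|y yK]; first by rewrite groupMr.
by rewrite scalerA mulgA (hc _ _ (groupM gaG (subsetP KG y yK)) xK) mulrC.
Qed.

(** The semi-invariants are the image of an averaging projector. It fixes J F[f],
    and by det_traces its trace is the dimension of J F[f] in each degree, so
    projector_image applies. *)
Lemma semi_invariant_det h : {in K, forall x, \det (U x) *: poly_act rG x h = h} ->
  exists p, h = J * (p \mPo f).
Proof.
move=> hh; have K0 : #|K|%:R != 0 :> F by rewrite pnatr_eq0 -lt0n cardG_gt0.
pose c g := #|K|%:R^-1 * \det (U g).
have fixL p : {in K, forall x, \det (U x) *: poly_act rG x p = p} ->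
    coset_act rG K c 1%g p = p.
  move=> hp; rewrite /coset_act (eq_bigr (fun=> #|K|%:R^-1 *: p)) => [|x xK].
    by rewrite sumr_const -scaler_nat scalerA mulfV // scale1r.
  by rewrite mul1g /c -scalerA hp.
have semiL p : {in K, forall x,
    \det (U x) *: poly_act rG x (coset_act rG K c 1%g p) = coset_act rG K c 1%g p}.
  apply: coset_act_semi_invariant => // g x gG xK.
  by rewrite /c repr_mxM ?(subsetP KG x xK) // det_mulmx mulrA.
have trL k : graded_trace k (coset_act rG K c 1%g) =
    if (E <= k)%N then complete_sum (fun=> 1) D (k - E) else 0.
  rewrite graded_trace_coset_act.
  rewrite (eq_bigr (fun y => #|K|%:R^-1 *
      (\det (U (1 * y)%g) * graded_trace k (poly_act rG (1 * y)%g)))) => [|y _]; last first.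
    by rewrite /c mulrA.
  rewrite -mulr_sumr -(@class_sum_traces (fun g => \det (U g)) 1%g k) //; last first.
    exact: orbit_det_class.
  under eq_bigr do rewrite mul1g.
  by rewrite det_traces; case: ifP => _; rewrite ?mulr0 // mulrA mulVf // mul1r.
have homL k p : p \is k.-homog -> coset_act rG K c 1%g p \is k.-homog.
  by move=> hp; apply: rpred_sum => x _; apply/rpredZ/poly_act_homog.
have fixJ m : coset_act rG K c 1%g (J * ('X_[m] \mPo f)) = J * ('X_[m] \mPo f).
  apply: fixL => x xK; rewrite rmorphM /=.
  have -> : poly_act rG x ('X_[m] \mPo f) = 'X_[m] \mPo f.
    rewrite (@poly_act_monomial _ _ _ _ _ _ _ (fun=> 1)).
      by rewrite big1 ?scale1r // => j _; rewrite expr1n.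
    by move=> j; rewrite scale1r; case: hf => _ _ ->.
  by rewrite scalerAl orbit_forms_det_inv.
exact: (projector_image f_homog f_indep J_neq0 J_homog homL
  (fun p => fixL _ (semiL p)) fixJ trL (fixL h hh)).
Qed.

Lemma basic_eigenvalue_norm ga e0 : ga \in G ->
    (forall j, poly_act rG ga (tnth f j) = e0 j *: tnth f j) ->
  forall j, `|e0 j| = 1.
Proof.
move=> gaG he j.
have f0 : tnth f j != 0.
  apply/eqP => fj0; have : 'X_j \mPo f = 0 by rewrite comp_mpolyXU -tnth_nth.
  move/f_indep/(congr1 (mcoeff U_(j)%MM)) => /eqP.
  by rewrite mcoeffX eqxx mcoeff0 oner_eq0.
have hX k : poly_act rG (ga ^+ k)%g (tnth f j) = (e0 j ^+ k) *: tnth f j.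
  elim: k => [|k IH]; first by rewrite expg0 poly_act1 scale1r.
  by rewrite expgS poly_actM ?groupX // he linearZ /= IH scalerA exprS.
have := hX #[ga]%g; rewrite expg_order poly_act1 => /eqP.
rewrite eq_sym -subr_eq0 -{2}[tnth f j]scale1r -scalerBl scaler_eq0 (negbTE f0) orbF.
rewrite subr_eq0 => /eqP e1; apply/eqP.
by rewrite -(@pexpr_eq1 _ _ #[ga]%g) ?order_gt0 // -normrX e1 normr1.
Qed.

(** Expanding by rows the determinant in orbit_forms_twist writes a multiple of J,
    times det (1 + U_g diag (v (d i))) g h, as a sum of terms det U_g (a * g (a' h)).
    After summation over the coset, L = \sum_g det U_g g has its image in J F[f] by semi_invariant_det,
    and graded_trace_transfer computes the trace. *)
Lemma twisted_trace ga e0 (v : nat -> F) k : ga \in G ->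
    (forall j, poly_act rG ga (tnth f j) = e0 j *: tnth f j) ->
  \sum_(x in K) \det (1%:M + U (ga * x)%g *m diag_mx (\row_i v (d i)))
      * complete_sum (ep (ga * x)%g) (de (ga * x)%g) k
  = \sum_(l < k.+1)
      (#|K|%:R *: \prod_j (1 + (e0 j * v (b j)) *: 'X^(D j - b j)))`_l
      * complete_sum e0 D (k - l)%N.
Proof.
move=> gaG he.
have he' x : x \in K -> forall j, poly_act rG (ga * x)%g (tnth f j) = e0 j *: tnth f j.
  move=> xK j; rewrite poly_actM ?(subsetP KG x xK) // he linearZ /=.
  by case: hf => _ _ ->.
pose c g := \det (1%:M + U g *m diag_mx (\row_i v (d i))).
rewrite (@class_sum_traces c ga k) // => [|g y gG yN]; last first.
  rewrite /c repr_mxM ?(subsetP NG y yN) //.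
  by rewrite (orbit_action1 hnf hU yN NG) mulmx1.
rewrite -graded_trace_coset_act.
pose w j := e0 j * v (b j).
pose mu := \prod_j e0 j.
(* The index of a term is a permutation with the set A of the rows taken from
   diag (w) Om: a is the product of the entries from these rows, a' is the product
   of the other entries, on which the group acts, with the sign. *)
pose a (i : 'S_n * {set 'I_n}) : S := \prod_(j in i.2) (w j *: Om j (i.1 j)).
pose a' (i : 'S_n * {set 'I_n}) : S :=
  (-1) ^+ i.1 * \prod_(j in ~: i.2) Om j (i.1 j).
pose l (i : 'S_n * {set 'I_n}) := (\sum_(j in i.2) (D j - b j))%N.
pose R := \prod_j (1 + w j *: 'X^(D j - b j)) : {poly F}.
have mu0 : mu != 0.
  apply/prodf_neq0 => j _.
  by rewrite -normr_eq0 (basic_eigenvalue_norm gaG he) oner_eq0.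
have expand (th : {rmorphism S -> S}) : \sum_i a i * th (a' i) =
    \det (\matrix_(j, m) (th (Om j m) + w j *: Om j m)).
  rewrite -(pair_bigA _ (fun s A => a (s, A) * th (a' (s, A)))).
  apply: eq_bigr => s _; rewrite /a /a' /=.
  under [in RHS]eq_bigr do rewrite mxE addrC.
  rewrite bigA_distr mulr_sumr; apply: eq_bigr => A _.
  rewrite rmorphM rmorph_sign rmorph_prod mulrCA; congr (_ * _).
  rewrite [RHS](bigID (mem A)) /=; congr (_ * _).
    by apply: eq_bigr => j ->.
  by apply: eq_big => [j|j]; rewrite inE // => /negbTE->.
have coefR m : \sum_(i | l i == m) a' i * a i = R`_m *: J.
  rewrite /R; under [in RHS]eq_bigr do rewrite addrC.
  rewrite bigA_distr coef_sum scaler_suml big_mkcond /=.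
  rewrite -(pair_bigA _ (fun s A => if l (s, A) == m then a' (s, A) * a (s, A) else 0)).
  rewrite exchange_big; apply: eq_bigr => A _ /=.
  have -> : \prod_j (if j \in A then w j *: 'X^(D j - b j) else 1)
      = (\prod_(j in A) w j) *: 'X^(\sum_(j in A) (D j - b j)) :> {poly F}.
    by rewrite -big_mkcond scaler_prod expr_sum.
  rewrite coefZ coefXn /l /= eq_sym; case: eqP => _; last first.
    by rewrite mulr0 scale0r big1.
  rewrite mulr1 scaler_sumr; apply: eq_bigr => s _.
  rewrite /a /a' /= scaler_prod -scalerAr -mulrA; congr (_ *: (_ * _)).
  rewrite mulrC [RHS](bigID (mem A)) /=; congr (_ * _).
  by apply: eq_bigl => j; rewrite inE.
rewrite (@graded_trace_transfer F n D f f_homog f_indep _ a a' l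
  (coset_act rG K (fun g => \det (U g)) ga) (mu *: J) _ e0
  (fun m => (#|K|%:R *: R)`_m) k) //.
- by rewrite scaler_eq0 negb_or mu0.
- move=> i; rewrite /a /l; elim/big_rec2: _ => [|j m p jA hp]; first exact: dhomog1.
  by apply: dhomogM => //; apply: rpredZ; apply: orbit_forms_homog.
- move=> h.
  have [|p hp] := @semi_invariant_det (coset_act rG K (fun g => \det (U g)) ga h).
    apply: coset_act_semi_invariant => // g x gG xK.
    by rewrite repr_mxM ?(subsetP KG x xK) // det_mulmx.
  exists (mu^-1 *: p); rewrite linearZ /= -scalerAl -scalerAr scalerA mulfV //.
  by rewrite scale1r.
- move=> m h; apply: coset_act_monomial KG hf _ _ _ _ _ gaG he.
- move=> m; rewrite -linear_sum coefR linearZ /=.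
  have -> : coset_act rG K (fun g => \det (U g)) ga J = #|K|%:R *: (mu *: J).
    rewrite /coset_act (eq_bigr (fun=> mu *: J)) => [|x xK].
      by rewrite sumr_const -scaler_nat.
    by rewrite (orbit_forms_det _ (he' x xK)) // groupM // (subsetP KG).
  by rewrite coefZ !scalerA; congr (_ *: _); ring.
- move=> h; rewrite /coset_act; under [RHS]eq_bigr do rewrite mulr_sumr.
  rewrite exchange_big mulr_sumr; apply: eq_bigr => x xK /=.
  have gxG : (ga * x)%g \in G by rewrite groupM // (subsetP KG).
  under [RHS]eq_bigr do rewrite rmorphM /= -scalerAr mulrA.
  rewrite -scaler_sumr -mulr_suml expand scalerAl.
  rewrite (orbit_forms_twist v gxG (he' x xK)) -scalerAr !scalerAl scalerA.
  by [].
Qed.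

(** With v k = c k * (1 - T) - 1 the factors of twisted_trace with eigenvalue 1 have
    a zero at T = 1 that cancels their pole, and the others do not depend on c at
    T = 1. *)
Lemma twisted_limit ga e0 (c : nat -> F) : ga \in G ->
    (forall j, poly_act rG ga (tnth f j) = e0 j *: tnth f j) ->
  \sum_(x in K) \prod_i (if ep (ga * x)%g i == 1
                         then c (de (ga * x)%g i) / (de (ga * x)%g i)%:R else 1)
  = #|K|%:R * \prod_j (if e0 j == 1
                      then (c (b j) + (D j - b j)%:R) / (D j)%:R else 1).
Proof.
move=> gaG he; have e1 := basic_eigenvalue_norm gaG he.
have gxG x : x \in K -> (ga * x)%g \in G by move=> xK; rewrite groupM // (subsetP KG).
pose num x := limit_num (ep (ga * x)%g) (fun=> 0%N) (fun i => c (de (ga * x)%g i)).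
pose den x := limit_den (ep (ga * x)%g) (de (ga * x)%g).
pose num0 := limit_num e0 (fun j => D j - b j)%N (fun j => c (b j)).
pose den0 := limit_den e0 D.
have cl : cleared K num den (#|K|%:R *: num0) den0 = 0.
  apply: poly_eq0_nat => l; set t := l.+2%:R.
  have t1 : t != 1 by rewrite (eqr_nat F _ 1).
  have tn1 : `|t| != 1 by rewrite normr_nat.
  have s0 : (spectral_poly e0 D).[t] != 0 by apply: spectral_poly_neq0.
  have sx x : x \in K -> (spectral (ga * x)%g).[t] != 0.
    by move=> xK; apply: spectral_neq0 => //; apply: gxG.
  apply/eqP; rewrite cleared_eq0; last exact: limit_den_neq0.
    (* The function v in twisted_trace is constant in T, so the identity is used
       at the points T = t one by one, each with its own v. *)
    pose v k := c k * (1 - t) - 1.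
    have hsp : {in K, forall x, inverse_series
        (complete_sum (ep (ga * x)%g) (de (ga * x)%g)) (spectral (ga * x)%g)}.
      by move=> x xK; apply/inverse_series_spectral/gxG.
    have hD : inverse_series (complete_sum e0 D) (spectral_poly e0 D).
      exact: inverse_series_complete_sum.
    have := proj2 (cleared_eq0_coef _ _ hsp hD) (fun k => twisted_trace v k gaG he).
    move/(congr1 (fun p : {poly F} => p.[t])); rewrite horner0 => /eqP.
    rewrite cleared_eq0 // => /eqP ev.
    rewrite hornerZ -mulrA limit_ratio //.
    move: ev; rewrite hornerZ -mulrA horner_prod.
    rewrite (eq_bigr (fun x => (num x).[t] / (den x).[t])) => [->|x xK].
      apply/eqP; congr (_ * (_ / _)); apply: eq_bigr => j _.
      by rewrite hornerD hornerZ hornerXn hornerC.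
    rewrite limit_ratio //; last exact: sx.
    rewrite hornerC; congr (_ / _).
    have [P hP] := hed (gxG x xK).
    have := joint_eigen_det hP (fun=> 1) v.
    rewrite (_ : diag_mx (\row__ 1) = 1%:M) => [->|]; last first.
      by apply/matrixP => p q; rewrite !mxE.
    by apply: eq_bigr => i _; rewrite expr0 mulr1.
  by move=> x xK; apply: limit_den_neq0 => //; apply: sx.
have /(congr1 (fun p : {poly F} => p.[1])) := cl; rewrite horner0 => /eqP.
rewrite cleared_eq0; last exact: limit_den1_neq0.
  move/eqP; rewrite hornerZ -mulrA limit_ratio1 => <-.
  apply: eq_bigr => x xK; rewrite limit_ratio1; apply: eq_bigr => i _.
  by case: ifP => _ //; rewrite addr0.
by move=> x xK; apply: limit_den1_neq0 => i; apply/de_gt0/gxG.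
Qed.

End OrbitPair.

Section OrbitPairLimit.

Variables (F : numFieldType) (gT : finGroupType) (G K N : {group gT}).
Hypotheses (KG : K \subset G) (NK : N \subset K).
Variables (n : nat) (rG : mx_representation F G n).
Variables (d : 'I_n -> nat) (nf : n.-tuple {mpoly F[n]}).
Hypothesis hnf : basic_invariants rG N d nf.
Variable U : mx_representation F G n.
Hypothesis hU : {in G, forall g i,
  poly_act rG g (tnth nf i) = \sum_j U g i j *: tnth nf j}.
Variables (D : 'I_n -> nat) (f : n.-tuple {mpoly F[n]}).
Hypothesis hf : basic_invariants rG K D f.
Variables (ep : gT -> 'I_n -> F) (de : gT -> 'I_n -> nat).
Hypothesis hed : {in G, forall g, exists P, joint_eigen (U g) d (ep g) (de g) P}.

(** The same b serves for all ga, e0 and c; this gives a single product for all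
    values of q and t, and for all cosets. *)
Theorem orbit_pair_limit : exists b : 'I_n -> nat,
  [/\ forall j, (b j <= D j)%N, forall j, exists i, b j = d i
    & forall ga e0 (c : nat -> F), ga \in G ->
        (forall j, poly_act rG ga (tnth f j) = e0 j *: tnth f j) ->
      \sum_(x in K) \prod_i (if ep (ga * x)%g i == 1
                         then c (de (ga * x)%g i) / (de (ga * x)%g i)%:R else 1)
      = #|K|%:R * \prod_j (if e0 j == 1
                      then (c (b j) + (D j - b j)%:R) / (D j)%:R else 1)].
Proof.
have [Fp [b [hFp J0]]] := orbit_forms_exist KG NK hnf hf.
have [s bs bD] := block_perm hnf hf hFp J0.
exists b; split=> [//|j|]; first by exists (s j); rewrite bs.
move=> ga e0 c gaG he; exact: (twisted_limit KG NK hnf hU hf hed hFp J0 c gaG he).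
Qed.

End OrbitPairLimit.

(** * Fixed spaces and the product formula *)

Section FixedSpaces.

Variables (F : numFieldType) (gT : finGroupType) (G : {group gT}) (n : nat).
Variable rG : mx_representation F G n.

Lemma fixdim_dual g : g \in G -> fixdim (dual_repr rG) g = fixdim rG g.
Proof.
move=> gG; rewrite /fixdim /fixmx !mxrank_ker; congr (n - _)%N.
have -> : 1%:M - dual_repr rG g = (1%:M - rG g^-1%g)^T.
  by rewrite linearB /= trmx1.
rewrite mxrank_tr -[LHS](mxrankMfree _ (_ : row_free (rG g))); last first.
  by rewrite row_free_unit repr_mx_unit.
rewrite mulmxBl mul1mx -repr_mxM ?groupV // mulVg repr_mx1 -opprB.
exact: mxrank_opp.
Qed.

Lemma fixdim_rsim (rM rN : mx_representation F G n) g : g \in G ->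
  mx_rsim rM rN -> fixdim rM g = fixdim rN g.
Proof.
move=> gG [B _ Bfree hB]; rewrite /fixdim /fixmx !mxrank_ker; congr (n - _)%N.
have Bu : B \in unitmx by rewrite -row_free_unit.
rewrite -[LHS](mxrankMfree _ Bfree) mulmxBl mul1mx hB // -{1}[B]mulmx1 -mulmxBr.
by rewrite (eqmxMfull (1%:M - rN g)) // row_full_unit.
Qed.

Lemma fixdim_eigen g d ep de P : joint_eigen (rG g) d ep de P ->
  fixdim rG g = #|[set i | ep i == 1]|.
Proof. exact: joint_eigen_rank. Qed.

Lemma fixdim_full g : mx_faithful rG -> g \in G -> fixdim rG g = n -> g = 1%g.
Proof.
move=> ff gG; rewrite /fixdim /fixmx mxrank_ker => e.
have r0 : \rank (1%:M - rG g) = 0%N.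
  have := rank_leq_row (1%:M - rG g); move: e; move: (\rank _) => k e kn.
  by apply/eqP; rewrite -(eqn_add2l (n - k)%N) subnK // addn0 e.
have : g \in rker rG.
  apply/rkerP; split=> //; apply/esym/eqP; rewrite -subr_eq0 -mxrank_eq0.
  by rewrite r0.
by move/(subsetP ff)/set1P.
Qed.

Lemma fixdim1 : fixdim rG 1%g = n.
Proof. by rewrite /fixdim /fixmx repr_mx1 subrr mxrank_ker mxrank0 subn0. Qed.

End FixedSpaces.

Section Main.

Variables (F : numClosedFieldType) (gT : finGroupType) (G : {group gT}) (n : nat).
Variable rG : mx_representation F G n.

(** For the trivial group the span of the basic invariants is the dual of V. *)
Lemma basic_invariants_trivial :
  basic_invariants rG [1 gT]%g (fun=> 1%N) [tuple 'X_i | i < n].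
Proof.
split.
- by move=> i; rewrite tnth_mktuple dhomogX; apply/eqP/mdeg1.
- by move=> p; rewrite comp_mpoly_id.
- by move=> i g /set1P->; rewrite poly_act1.
- by move=> h _; exists h; rewrite comp_mpoly_id.
Qed.

Lemma dual_action : {in G, forall g i,
  poly_act rG g (tnth [tuple 'X_i | i < n] i) =
    \sum_j dual_repr rG g i j *: tnth [tuple 'X_i | i < n] j}.
Proof.
move=> g gG i; rewrite tnth_mktuple poly_actX; apply: eq_bigr => j _.
by rewrite tnth_mktuple mxE.
Qed.

Lemma joint_eigen_data (U : mx_representation F G n) d :
    {in G, forall g i j, U g i j != 0 -> d i = d j} ->
  exists (ep : gT -> 'I_n -> F) (de : gT -> 'I_n -> nat),
    {in G, forall g, exists P, joint_eigen (U g) d (ep g) (de g) P}.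
Proof.
move=> hb; have hex g : exists ed : ('I_n -> F) * ('I_n -> nat),
    g \in G -> exists P, joint_eigen (U g) d ed.1 ed.2 P.
  have [gG|_] := boolP (g \in G); last by exists (fun=> 0, fun=> 0%N).
  by have [ed hed] := joint_eigen_exists gG (hb g gG); exists ed.
have [ed hed] := fin_all_exists hex.
by exists (fun g => (ed g).1), (fun g => (ed g).2).
Qed.

Lemma joint_eigen_unweighted (U : 'M[F]_n) ep de P :
  joint_eigen U (fun=> 1%N) ep de P -> joint_eigen U (fun=> 1%N) ep (fun=> 1%N) P.
Proof. by case=> Pu PU _; split. Qed.

Lemma prod_eigen_const (ep : 'I_n -> F) (x : F) :
  \prod_i (if ep i == 1 then x else 1) = x ^+ #|[set i | ep i == 1]|.
Proof. by rewrite -big_mkcond prodr_const cardsE. Qed.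

Lemma poly_act1_eigen (f : n.-tuple {mpoly F[n]}) j :
  poly_act rG 1%g (tnth f j) = 1 *: tnth f j.
Proof. by rewrite poly_act1 scale1r. Qed.

(** This is orbit_pair_limit for the trivial group inside N, where all the weights
    are 1, with c the constant q. *)
Lemma coset_fixdim_sum (N : {group gT}) D f g e0 (q : F) : N \subset G ->
    basic_invariants rG N D f -> g \in G ->
    (forall j, poly_act rG g (tnth f j) = e0 j *: tnth f j) ->
  \sum_(x in N) q ^+ fixdim rG (g * x)%g
  = #|N|%:R * \prod_j (if e0 j == 1 then (q + (D j - 1)%:R) / (D j)%:R else 1).
Proof.
move=> NG hf gG he.
have [ep1 [de1 h1]] := joint_eigen_data (d := fun=> 1%N)
  (U := dual_repr rG) (fun _ _ _ _ _ => erefl).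
have h1' : {in G, forall g, exists P,
    joint_eigen (dual_repr rG g) (fun=> 1%N) (ep1 g) (fun=> 1%N) P}.
  by move=> y yG; have [Q /joint_eigen_unweighted hQ] := h1 y yG; exists Q.
have [b [_ b1 lim]] :=
  orbit_pair_limit NG (sub1G N) basic_invariants_trivial dual_action hf
    (de := fun _ _ => 1%N) h1'.
have := lim g e0 (fun=> q) gG he.
rewrite (eq_bigr (fun x => q ^+ fixdim rG (g * x)%g)) => [->|x xN].
  congr (_ * _); apply: eq_bigr => j _; case: ifP => // _.
  by have [i ->] := b1 j.
have gxG : (g * x)%g \in G by rewrite groupM // (subsetP NG).
have [Q hQ] := h1' _ gxG.
by rewrite divr1 prod_eigen_const -(fixdim_eigen hQ) fixdim_dual.
Qed.

(** In coset_fixdim_sum for the group G itself, the coefficient of the highest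
    power of q is 1 on the left, as only the identity fixes V, and
    #|G| / \prod_j D j on the right. *)
Lemma card_prod_degrees D f : mx_faithful rG ->
  basic_invariants rG G D f -> #|G|%:R = \prod_j (D j)%:R :> F.
Proof.
move=> ff hf; have [hh hi hinv _] := hf.
have D0 : \prod_j (D j)%:R != 0 :> F.
  by apply/prodf_neq0 => j _; rewrite pnatr_eq0 -lt0n (degree_gt0 hi (hh j)).
pose p : {poly F} := \sum_(g in G) 'X^(fixdim rG g).
pose u : {poly F} := \prod_j ('X - (- (D j - 1)%:R)%:P).
pose c := #|G|%:R / \prod_j (D j)%:R : F.
have pp : p = c *: u.
  apply/eqP; rewrite -subr_eq0; apply/eqP/poly_eq0_nat => k.
  rewrite hornerD hornerN hornerZ horner_sum horner_prod.
  have := coset_fixdim_sum k.+2%:R (subxx G) hf (group1 G) (poly_act1_eigen f).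
  rewrite (eq_bigr (fun g => ('X^(fixdim rG g)).[k.+2%:R])) => [->|g gG]; last first.
    by rewrite mul1g hornerXn.
  rewrite /c -mulrA [_^-1 * _]mulrC; apply/eqP; rewrite subr_eq0; apply/eqP.
  congr (_ * _); rewrite -prodf_div; apply: eq_bigr => j _.
  by rewrite eqxx hornerD hornerN hornerX hornerC opprK.
have pn : p`_n = 1.
  rewrite coef_sum (bigD1 1%g) //= coefXn fixdim1 eqxx big1 ?addr0 // => g.
  case/andP=> gG g1; rewrite coefXn; case: eqP => // e.
  by rewrite (fixdim_full ff gG (esym e)) eqxx in g1.
have un : u`_n = 1.
  have um : u \is monic by apply: monic_prod_XsubC.
  have su : size u = n.+1.
    by rewrite /u size_prod_XsubC; rewrite -[n in RHS]card_ord cardE enumT.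
  by move: um; rewrite monicE lead_coefE su => /eqP.
move: pn; rewrite pp coefZ un mulr1 /c => e.
by rewrite -[LHS](divfK D0) e mul1r.
Qed.

(** On a coset g N the exponent of t is constant, equal to the number of eigenvalues
    1 of U_g, and coset_fixdim_sum gives the sum of the powers of q. The result is
    a product over these eigenvalues of c (de g i) / de g i with
    c k = (q + k - 1) t, so that orbit_pair_limit for N inside G sums it. *)
Lemma fixdim_sum_values (N : {group gT}) d nf D f
    (U rM : mx_representation F G n) : mx_faithful rG -> N \subset G ->
    basic_invariants rG N d nf -> basic_invariants rG G D f ->
    {in G, forall g i, poly_act rG g (tnth nf i) = \sum_j U g i j *: tnth nf j} ->
    mx_rsim rM (dual_repr U) ->
  exists b : 'I_n -> nat, [/\ forall j, (b j <= D j)%N, forall j, (0 < b j)%N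
    & forall q t : F,
      \sum_(g in G) q ^+ fixdim rG g * t ^+ fixdim rM g =
      \prod_j ((q + (b j - 1)%:R) * t + (D j - b j)%:R)].
Proof.
move=> ff NG hnf hf hU rsim.
have [hh hi hinv _] := hf; have [nh ni _ _] := hnf.
have d0 i : (0 < d i)%N := degree_gt0 ni (nh i).
have [ep [de hed]] := joint_eigen_data (fun g gG i j =>
  orbit_action_block hnf hU (g := g) (i := i) (j := j) gG).
have [b [bD bd lim]] := orbit_pair_limit (subxx G) NG hnf hU hf hed.
exists b; split=> // [j|q t]; first by have [i ->] := bd j.
have fixM g : g \in G -> fixdim rM g = #|[set i | ep g i == 1]|.
  move=> gG; rewrite (fixdim_rsim gG rsim) fixdim_dual //.
  by have [P hP] := hed g gG; apply: fixdim_eigen hP.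
have fixMN g x : g \in G -> x \in N -> fixdim rM (g * x)%g = fixdim rM g.
  move=> gG xN; have xG := subsetP NG x xN.
  rewrite !(fixdim_rsim _ rsim) ?groupM // !fixdim_dual ?groupM //.
  by rewrite /fixdim repr_mxM // (orbit_action1 hnf hU xN NG) mulmx1.
have N0 : #|N|%:R != 0 :> F by rewrite pnatr_eq0 -lt0n cardG_gt0.
pose c k := (q + (k - 1)%:R) * t.
have coset g : g \in G ->
    \sum_(x in N) q ^+ fixdim rG (g * x)%g * t ^+ fixdim rM (g * x)%g =
    #|N|%:R * \prod_i (if ep g i == 1 then c (de g i) / (de g i)%:R else 1).
  move=> gG; have [P hP] := hed g gG.
  have [hf' he'] := eigen_invariants hnf hU gG hP.
  rewrite (eq_bigr (fun x => q ^+ fixdim rG (g * x)%g * t ^+ fixdim rM g)); last first.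
    by move=> x xN; rewrite fixMN.
  rewrite -mulr_suml (coset_fixdim_sum q NG hf' gG he') -mulrA; congr (_ * _).
  rewrite fixM // -prod_eigen_const -big_split; apply: eq_bigr => i _ /=.
  by case: ifP => _; rewrite /c ?mulr1 // mulrAC.
have total : #|N|%:R * \sum_(g in G) q ^+ fixdim rG g * t ^+ fixdim rM g =
    \sum_(g in G) \sum_(x in N)
      q ^+ fixdim rG (g * x)%g * t ^+ fixdim rM (g * x)%g.
  rewrite exchange_big -sum1_card natr_sum mulr_suml; apply: eq_bigr => x xN.
  rewrite mul1r [LHS](reindex_inj (mulIg x)) /=.
  by apply: eq_bigl => g; rewrite groupMr // (subsetP NG).
apply: (mulfI N0); rewrite total (eq_bigr _ coset) -mulr_sumr; congr (_ * _).
have := lim 1%g (fun=> 1) c (group1 G) (poly_act1_eigen f).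
rewrite (eq_bigr (fun g => \prod_i
  (if ep g i == 1 then c (de g i) / (de g i)%:R else 1))) => [->|g _]; last first.
  by rewrite mul1g.
rewrite (card_prod_degrees ff hf) -big_split; apply: eq_bigr => j _ /=.
by rewrite eqxx mulrC divfK // pnatr_eq0 -lt0n (degree_gt0 hi (hh j)).
Qed.

End Main.

(** The integers embed in F, and a polynomial over F that vanishes at infinitely
    many points is 0; this is applied to one variable after the other. *)
Lemma mpoly2_eq_values (F : numFieldType) (p p' : {mpoly int[2]}) :
  (forall phi : {rmorphism {mpoly int[2]} -> F}, phi p = phi p') -> p = p'.
Proof.
move=> h; apply/eqP; rewrite -subr_eq0; apply/eqP.
have {h} : forall q t : F,
    mmap (intr : int -> F) (fun i : 'I_2 => if i == 0 then q else t) (p - p') = 0.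
  by move=> q t; rewrite raddfB /= h subrr.
move: (p - p') => r h; pose B := msize r.
have ev q t : \sum_(m : 'X_{1..2 < B}) (r@_m)%:~R * (q ^+ m 0 * t ^+ m 1) = 0 :> F.
  rewrite -[RHS](h q t) (@mmapE _ _ _ _ _ r B (leqnn B)); apply: eq_bigr => m _.
  congr (_ * _).
  rewrite /mmap1 !big_ord_recl big_ord0 mulr1.
  by have -> : lift ord0 ord0 = 1 :> 'I_2 by apply: val_inj.
have ev2 t a : \sum_(m : 'X_{1..2 < B} | m 0 == a) (r@_m)%:~R * t ^+ m 1 = 0 :> F.
  pose P : {poly F} := \sum_(m : 'X_{1..2 < B}) ((r@_m)%:~R * t ^+ m 1) *: 'X^(m 0).
  have P0 : P = 0.
    apply: poly_eq0_nat => k; rewrite -[RHS](ev k.+2%:R t) horner_sum.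
    by apply: eq_bigr => m _; rewrite hornerZ hornerXn mulrAC mulrA.
  have /(congr1 (fun P : {poly F} => P`_a)) := P0.
  rewrite coef0 coef_sum => e; rewrite big_mkcond -[RHS]e.
  apply: eq_bigr => m _; rewrite coefZ coefXn eq_sym.
  by case: eqP; rewrite ?mulr1 ?mulr0.
apply/mpolyP => m; rewrite mcoeff0; apply/eqP; rewrite -(intr_eq0 F); apply/eqP.
have [mB|Bm] := ltnP (mdeg m) B; last first.
  by rewrite memN_msupp_eq0 // msize_mdeg_ge.
pose Q : {poly F} := \sum_(l : 'X_{1..2 < B} | l 0 == m 0) (r@_l)%:~R *: 'X^(l 1).
have Q0 : Q = 0.
  apply: poly_eq0_nat => k; rewrite -[RHS](ev2 k.+2%:R (m 0)) horner_sum.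
  by apply: eq_bigr => l _; rewrite hornerZ hornerXn.
have /(congr1 (fun P : {poly F} => P`_(m 1))) := Q0.
rewrite coef0 coef_sum (bigD1 (BMultinom mB)) //= coefZ coefXn eqxx mulr1.
rewrite big1 ?addr0 // => l /andP[/eqP l0 lm]; rewrite coefZ coefXn.
case: eqP => [l1|]; last by rewrite mulr0.
case/eqP: lm; apply: val_inj; apply/mnmP => i /=.
by case: i => [[|[|//]] hi]; [move: l0 | move: l1] => e;
  [rewrite (_ : Ordinal hi = 0) | rewrite (_ : Ordinal hi = 1)] => //; exact: val_inj.
Qed.

Theorem corollary5p1 (R : realType) (gT : finGroupType) (G : {group gT})
  (r : nat) (rG : mx_representation R[i] G r)
  (hG : complex_reflection_group rG)
  (e : 'I_r -> nat) (he : exponents rG e)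
  (Hs : seq 'M[R[i]]_r) (hHs : hyperplane_orbit rG Hs)
  (rM : mx_representation R[i] G r)
  (hM : orbit_space_repr rG (orbit_subgroup rG Hs) rM) :
  factorizing rG e rM.
Proof.
have [ff _] := hG; have [D [f [hf eD]]] := he.
have [d [nf [U [hnf hU rsim]]]] := hM.
have NG : orbit_subgroup rG Hs \subset G.
  by rewrite gen_subG; apply/subsetP => s; rewrite inE => /and3P[].
have [b [bD b0 vals]] := fixdim_sum_values ff NG hnf hf hU rsim.
(* The exponent D j - 1 is the sum of b j - 1 and D j - b j. *)
exists (fun j => D j - b j)%N; apply: (@mpoly2_eq_values R[i]) => phi.
rewrite rmorph_sum rmorph_prod.
rewrite (eq_bigr (fun g => phi 'X_0 ^+ fixdim rG g * phi 'X_1 ^+ fixdim rM g)); last first.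
  by move=> g _; rewrite (rmorphM phi) !(rmorphXn phi).
rewrite vals; apply: eq_bigr => j _.
rewrite !rmorphD !rmorphM rmorphB !rmorph_nat eD.
rewrite !natrB //; last by apply: leq_trans (b0 j) (bD j).
by ring.
Qed.
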